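(* The morphism of symmetric differential graded operads $\mathrm{Trias}\to\mathrm{As}$, where $\mathrm{As}$ has zero differential, sending $1\dashv2$ and $1\vdash2$ to the associative product and $1\times2$ to $0$, is a quasi-isomorphism.
   Context: All operads are in complexes of $\mathbb{Z}$-modules; a morphism is a quasi-isomorphism if it is one in each arity. $\mathrm{As}$ is the symmetric operad of (non-unital) associative algebras. $\mathrm{Trias}$ is the symmetric operad associated to the non-symmetric operad $\mathrm{Trias}'$ (so $\mathrm{Trias}(n)=\mathrm{Trias}'(n)\otimes\mathbb{Z}[\mathfrak S_n]$). $\mathrm{Trias}'$ is the non-symmetric differential graded operad generated by elements $1\dashv2$, $1\vdash 2$ of arity $2$ and dimension $0$ and $1\times 2$ of arity $2$ and dimension $1$, subject to the relations \begin{align*} (1 \dashv 2)\circ_1 (1 \vdash 2)&=(1 \vdash 2)\circ_2 (1 \dashv 2),\\ (1 \dashv 2)\circ_2 (1 \dashv 2)&=(1 \dashv 2)\circ_2 (1 \vdash 2)=(1 \dashv 2)\circ_1 (1 \dashv 2),\\ (1 \vdash 2)\circ_1 (1 \vdash 2)&=(1 \vdash 2)\circ_1 (1 \dashv 2)=(1 \vdash 2)\circ_2 (1 \vdash 2),\\ (1\times 2)\circ_1 (1 \vdash 2)&=(1 \vdash 2)\circ_2 (1\times 2),\\ (1\times 2)\circ_2 (1 \dashv 2)&=(1 \dashv 2)\circ_1 (1\times 2),\\ (1\times 2)\circ_1 (1 \dashv 2)&=(1\times 2)\circ_2 (1 \vdash 2),\\ (1 \vdash 2)\circ_1 (1\times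 2)&=0,\qquad (1\dashv 2)\circ_2 (1 \times 2)=0,\\ (1\times 2)\circ_1 (1\times 2)&=-(1\times 2)\circ_2 (1\times 2), \end{align*} with differential (lowering dimension by one) determined by $d(1\times 2)=1\dashv 2- 1\vdash 2$ and $d(1\vdash 2)=d(1\dashv 2)=0$. *)

(* Defs.v *)
From HB Require Import structures.
From mathcomp Require Import all_boot all_order perm all_algebra.
From mathcomp Require Import boolp.
From mathcomp Require Import zify.

Set Implicit Arguments.
Unset Strict Implicit.
Unset Printing Implicit Defensive.

Import GRing.Theory.
Local Open Scope ring_scope.
Local Open Scope quotient_scope.

(* Homologically graded complexes of Z-modules.  The degrees of the source   *)
(* and of the target of the differential are related by a proof, here as in  *)
(* the compositions below, so that no transport along equalities of degrees  *)
(* is ever needed.                                                           *)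

Record complex := Complex {
  cx_obj :> int -> zmodType;
  cx_d : forall k l : int, k = l + 1 -> {additive cx_obj k -> cx_obj l};
  cx_dd : forall (k l m : int) (h : k = l + 1) (h' : l = m + 1) (x : cx_obj k),
    cx_d h' (cx_d h x) = 0
}.
Arguments cx_d {c k l}.

Record chain_map (C D : complex) := ChainMap {
  cm_fun :> forall k : int, {additive C k -> D k};
  cm_d : forall (k l : int) (h : k = l + 1) (x : C k),
    cm_fun l (cx_d h x) = cx_d h (cm_fun k x)
}.

Lemma pred_degree (k : int) : k = k - 1 + 1. Proof. by rewrite subrK. Qed.

Definition cyclep (C : complex) (k : int) : {pred C k} :=
  fun x => cx_d (pred_degree k) x == 0.

Lemma cyclep_zmod_closed (C : complex) (k : int) : zmod_closed (@cyclep C k).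
Proof.
split; first by rewrite /in_mem /= /cyclep raddf0.
move=> x y; rewrite /in_mem /= /cyclep => /eqP hx /eqP hy.
by rewrite raddfB hx hy subr0.
Qed.

HB.instance Definition _ (C : complex) (k : int) :=
  GRing.isZmodClosed.Build (C k) (@cyclep C k) (cyclep_zmod_closed C k).

Record cycles (C : complex) (k : int) := Cycle {
  cycle_val :> C k;
  cycleP : cyclep cycle_val
}.
HB.instance Definition _ (C : complex) (k : int) :=
  [isSub for @cycle_val C k].
HB.instance Definition _ (C : complex) (k : int) :=
  [Choice of cycles C k by <:].
HB.instance Definition _ (C : complex) (k : int) :=
  [SubChoice_isSubZmodule of cycles C k by <:].

Definition boundaryp (C : complex) (k : int) : {pred cycles C k} :=
  fun x => `[< exists y : C (k + 1), cx_d (erefl (k + 1)) y = val x >].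

Lemma boundaryp_zmod_closed (C : complex) (k : int) :
  zmod_closed (@boundaryp C k).
Proof.
split; first by apply/asboolP; exists 0; rewrite raddf0.
move=> x y /asboolP[u hu] /asboolP[v hv]; apply/asboolP; exists (u - v).
by rewrite raddfB hu hv.
Qed.

HB.instance Definition _ (C : complex) (k : int) :=
  GRing.isZmodClosed.Build (cycles C k) (@boundaryp C k)
    (boundaryp_zmod_closed C k).

Definition homology (C : complex) (k : int) : zmodType :=
  Quotient.quot (@boundaryp C k).

Lemma chain_map_cycle (C D : complex) (f : chain_map C D) (k : int)
  (x : cycles C k) : cyclep (f k (val x)).
Proof. by rewrite /cyclep -cm_d (eqP (cycleP x)) raddf0. Qed.

Definition cycles_map (C D : complex) (f : chain_map C D) (k : int)
  (x : cycles C k) : cycles D k := Cycle (chain_map_cycle f x).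

Definition homology_map (C D : complex) (f : chain_map C D) (k : int)
  (x : homology C k) : homology D k :=
  \pi_(homology D k) (cycles_map f (repr x)).

Lemma homology_map_pi (C D : complex) (f : chain_map C D) (k : int)
  (x : cycles C k) :
  homology_map f (\pi_(homology C k) x)
    = \pi_(homology D k) (cycles_map f x).
Proof.
apply/eqP; rewrite -Quotient.idealrBE; apply/asboolP.
have: (repr (\pi_(homology C k) x) - x) \in @boundaryp C k.
  by rewrite Quotient.idealrBE reprK.
move=> /asboolP[y hy]; exists (f _ y).
by rewrite -cm_d hy !raddfB.
Qed.

Definition quasi_iso (C D : complex) (f : chain_map C D) : Prop :=
  forall k : int, bijective (@homology_map C D f k).

(* The Koszul sign (-1)^e. *)
Definition koszul (V : zmodType) (e : int) (x : V) : V :=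
  if odd `|e|%N then - x else x.

(* Non-symmetric operads in complexes, in terms of partial compositions.     *)
(* Inputs are numbered from 0: [ns_comp i] is the composition usually        *)
(* written with index i + 1.                                                 *)
Record nsOperad := NsOperad {
  ns_cx :> nat -> complex;
  ns_id : ns_cx 1%N 0;
  ns_comp : forall (m n r : nat) (p q s : int),
    'I_m -> r.+1 = (m + n)%N -> s = p + q ->
    ns_cx m p -> ns_cx n q -> ns_cx r s;
  ns_compDl : forall m n r p q s (i : 'I_m) (hr : r.+1 = (m + n)%N)
      (hs : s = p + q) (x x' : ns_cx m p) (y : ns_cx n q),
    ns_comp i hr hs (x + x') y = ns_comp i hr hs x y + ns_comp i hr hs x' y;
  ns_compDr : forall m n r p q s (i : 'I_m) (hr : r.+1 = (m + n)%N)
      (hs : s = p + q) (x : ns_cx m p) (y y' : ns_cx n q),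
    ns_comp i hr hs x (y + y') = ns_comp i hr hs x y + ns_comp i hr hs x y';
  ns_comp1l : forall n q (i : 'I_1) (hr : n.+1 = (1 + n)%N) (hs : q = 0 + q)
      (x : ns_cx n q),
    ns_comp i hr hs ns_id x = x;
  ns_comp1r : forall m p (i : 'I_m) (hr : m.+1 = (m + 1)%N) (hs : p = p + 0)
      (x : ns_cx m p),
    ns_comp i hr hs x ns_id = x;
  ns_comp_seq : forall m n l r r' w (p q t s s' v : int)
      (i : 'I_m) (j : 'I_n) (k : 'I_r)
      (hr : r.+1 = (m + n)%N) (hs : s = p + q)
      (hw : w.+1 = (r + l)%N) (hv : v = s + t)
      (hr' : r'.+1 = (n + l)%N) (hs' : s' = q + t)
      (hw' : w.+1 = (m + r')%N) (hv' : v = p + s')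
      (x : ns_cx m p) (y : ns_cx n q) (z : ns_cx l t),
    k = (i + j)%N :> nat ->
    ns_comp k hw hv (ns_comp i hr hs x y) z
      = ns_comp i hw' hv' x (ns_comp j hr' hs' y z);
  ns_comp_par : forall m n l r r' w (p q t s s' v : int)
      (i k : 'I_m) (i' : 'I_r') (k' : 'I_r)
      (hr : r.+1 = (m + n)%N) (hs : s = p + q)
      (hw : w.+1 = (r + l)%N) (hv : v = s + t)
      (hr' : r'.+1 = (m + l)%N) (hs' : s' = p + t)
      (hw' : w.+1 = (r' + n)%N) (hv' : v = s' + q)
      (x : ns_cx m p) (y : ns_cx n q) (z : ns_cx l t),
    (i < k)%N -> i' = i :> nat -> k'.+1 = (k + n)%N ->
    ns_comp k' hw hv (ns_comp i hr hs x y) z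
      = koszul (q * t) (ns_comp i' hw' hv' (ns_comp k hr' hs' x z) y);
  ns_comp_d : forall m n r (p q s p' q' s' : int) (i : 'I_m)
      (hr : r.+1 = (m + n)%N) (hs : s = p + q)
      (hp : p = p' + 1) (hq : q = q' + 1) (hd : s = s' + 1)
      (hl : s' = p' + q) (hr' : s' = p + q')
      (x : ns_cx m p) (y : ns_cx n q),
    cx_d hd (ns_comp i hr hs x y)
      = ns_comp i hr hl (cx_d hp x) y
        + koszul p (ns_comp i hr hr' x (cx_d hq y))
}.

(* Presentations of non-symmetric dg operads.  The terms are the formal      *)
(* expressions in the operations of a dg operad, differential included; two  *)
(* terms are identified when this follows from the axioms of dg operads and  *)
(* the given relations, so the quotient is the universal dg operad equipped  *)
(* with generators satisfying the relations (see [teval_teq]).  The          *)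
(* differentials of the generators are prescribed by relations involving     *)
(* [tdiff].                                                                  *)

Record signature := Signature {
  gen : Type;
  arity : gen -> nat;
  degree : gen -> int
}.

Inductive term (G : signature) : nat -> int -> Type :=
| tgen (g : gen G) : term G (arity g) (degree g)
| tid : term G 1%N 0
| tcomp (m n r : nat) (p q s : int) (i : 'I_m) (hr : r.+1 = (m + n)%N)
    (hs : s = p + q) (x : term G m p) (y : term G n q) : term G r s
| tdiff (n : nat) (k l : int) (h : k = l + 1) (x : term G n k) : term G n l
| tzero (n : nat) (k : int) : term G n k
| topp (n : nat) (k : int) (x : term G n k) : term G n k
| tadd (n : nat) (k : int) (x y : term G n k) : term G n k.
Arguments tgen {G} g.
Arguments tid {G}.
Arguments tzero {G n k}.

Definition tkoszul (G : signature) n k (e : int) (x : term G n k) :=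
  if odd `|e|%N then topp x else x.

Record presentation := Presentation {
  pres_sig :> signature;
  pres_rel : forall n k, term pres_sig n k -> term pres_sig n k -> Prop
}.

Inductive teq (P : presentation) :
  forall n k, term P n k -> term P n k -> Prop :=
| teq_rel n k (x y : term P n k) : pres_rel x y -> teq x y
| teq_refl n k (x : term P n k) : teq x x
| teq_sym n k (x y : term P n k) : teq x y -> teq y x
| teq_trans n k (x y z : term P n k) : teq x y -> teq y z -> teq x z
| teq_opp n k (x y : term P n k) : teq x y -> teq (topp x) (topp y)
| teq_add n k (x x' y y' : term P n k) :
    teq x x' -> teq y y' -> teq (tadd x y) (tadd x' y')
| teq_diff n k l (h : k = l + 1) (x y : term P n k) :
    teq x y -> teq (tdiff h x) (tdiff h y)
| teq_comp m n r p q s (i : 'I_m) (hr : r.+1 = (m + n)%N) (hs : s = p + q)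
      (x x' : term P m p) (y y' : term P n q) :
    teq x x' -> teq y y' -> teq (tcomp i hr hs x y) (tcomp i hr hs x' y')
| teq_addA n k (x y z : term P n k) :
    teq (tadd x (tadd y z)) (tadd (tadd x y) z)
| teq_addC n k (x y : term P n k) : teq (tadd x y) (tadd y x)
| teq_add0 n k (x : term P n k) : teq (tadd tzero x) x
| teq_addN n k (x : term P n k) : teq (tadd (topp x) x) tzero
| teq_diffD n k l (h : k = l + 1) (x y : term P n k) :
    teq (tdiff h (tadd x y)) (tadd (tdiff h x) (tdiff h y))
| teq_diff_diff n k l m (h : k = l + 1) (h' : l = m + 1) (x : term P n k) :
    teq (tdiff h' (tdiff h x)) tzero
| teq_compDl m n r p q s (i : 'I_m) (hr : r.+1 = (m + n)%N) (hs : s = p + q)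
      (x x' : term P m p) (y : term P n q) :
    teq (tcomp i hr hs (tadd x x') y)
        (tadd (tcomp i hr hs x y) (tcomp i hr hs x' y))
| teq_compDr m n r p q s (i : 'I_m) (hr : r.+1 = (m + n)%N) (hs : s = p + q)
      (x : term P m p) (y y' : term P n q) :
    teq (tcomp i hr hs x (tadd y y'))
        (tadd (tcomp i hr hs x y) (tcomp i hr hs x y'))
| teq_comp1l n q (i : 'I_1) (hr : n.+1 = (1 + n)%N) (hs : q = 0 + q)
      (x : term P n q) :
    teq (tcomp i hr hs tid x) x
| teq_comp1r m p (i : 'I_m) (hr : m.+1 = (m + 1)%N) (hs : p = p + 0)
      (x : term P m p) :
    teq (tcomp i hr hs x tid) x
| teq_comp_seq m n l r r' w (p q t s s' v : int)
      (i : 'I_m) (j : 'I_n) (k : 'I_r)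
      (hr : r.+1 = (m + n)%N) (hs : s = p + q)
      (hw : w.+1 = (r + l)%N) (hv : v = s + t)
      (hr' : r'.+1 = (n + l)%N) (hs' : s' = q + t)
      (hw' : w.+1 = (m + r')%N) (hv' : v = p + s')
      (x : term P m p) (y : term P n q) (z : term P l t) :
    k = (i + j)%N :> nat ->
    teq (tcomp k hw hv (tcomp i hr hs x y) z)
        (tcomp i hw' hv' x (tcomp j hr' hs' y z))
| teq_comp_par m n l r r' w (p q t s s' v : int)
      (i k : 'I_m) (i' : 'I_r') (k' : 'I_r)
      (hr : r.+1 = (m + n)%N) (hs : s = p + q)
      (hw : w.+1 = (r + l)%N) (hv : v = s + t)
      (hr' : r'.+1 = (m + l)%N) (hs' : s' = p + t)
      (hw' : w.+1 = (r' + n)%N) (hv' : v = s' + q)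
      (x : term P m p) (y : term P n q) (z : term P l t) :
    (i < k)%N -> i' = i :> nat -> k'.+1 = (k + n)%N ->
    teq (tcomp k' hw hv (tcomp i hr hs x y) z)
        (tkoszul (q * t) (tcomp i' hw' hv' (tcomp k hr' hs' x z) y))
| teq_comp_d m n r (p q s p' q' s' : int) (i : 'I_m)
      (hr : r.+1 = (m + n)%N) (hs : s = p + q)
      (hp : p = p' + 1) (hq : q = q' + 1) (hd : s = s' + 1)
      (hl : s' = p' + q) (hr' : s' = p + q')
      (x : term P m p) (y : term P n q) :
    teq (tdiff hd (tcomp i hr hs x y))
        (tadd (tcomp i hr hl (tdiff hp x) y)
              (tkoszul p (tcomp i hr hr' x (tdiff hq y)))).

HB.instance Definition _ (G : signature) n k := gen_eqMixin (term G n k).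
HB.instance Definition _ (G : signature) n k := gen_choiceMixin (term G n k).

Definition teqb (P : presentation) n k : rel (term P n k) :=
  fun x y => `[< teq x y >].

Lemma teqb_equiv (P : presentation) n k : equiv_class_of (@teqb P n k).
Proof.
split=> [x|x y|y x z]; first by apply/asboolP; apply: teq_refl.
  by apply/asboolP/asboolP; apply: teq_sym.
move=> /asboolP hxy /asboolP hyz; apply/asboolP.
exact: teq_trans hxy hyz.
Qed.

Canonical teqb_equivRel (P : presentation) n k :=
  EquivRelPack (teqb_equiv P n k).

Definition pres_obj (P : presentation) n k := {eq_quot (@teqb P n k)}.

HB.instance Definition _ (P : presentation) n k :=
  Choice.on (@pres_obj P n k).

Definition tclass (P : presentation) n k (x : term P n k) : pres_obj P n k :=
  \pi_({eq_quot (@teqb P n k)}) x.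

Definition trepr (P : presentation) n k (x : pres_obj P n k) : term P n k :=
  repr (x : {eq_quot (@teqb P n k)}).

Lemma tclassP (P : presentation) n k (x y : term P n k) :
  tclass x = tclass y <-> teq x y.
Proof.
split; first by move/eqmodP => /asboolP.
by move=> h; apply/eqmodP/asboolP.
Qed.

Lemma treprK (P : presentation) n k (x : pres_obj P n k) :
  tclass (trepr x) = x.
Proof. exact: reprK. Qed.

Lemma teq_trepr (P : presentation) n k (x : term P n k) :
  teq (trepr (tclass x)) x.
Proof. by apply/tclassP; rewrite treprK. Qed.

Lemma tclass_ind (P : presentation) n k (Q : pres_obj P n k -> Prop) :
  (forall x, Q (tclass x)) -> forall x, Q x.
Proof. by move=> h x; rewrite -[x]treprK. Qed.

Definition pres_zero (P : presentation) n k : pres_obj P n k := tclass tzero.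
Definition pres_opp (P : presentation) n k (x : pres_obj P n k) :=
  tclass (topp (trepr x)).
Definition pres_add (P : presentation) n k (x y : pres_obj P n k) :=
  tclass (tadd (trepr x) (trepr y)).

Lemma pres_oppE (P : presentation) n k (x : term P n k) :
  pres_opp (tclass x) = tclass (topp x).
Proof. by apply/tclassP/teq_opp/teq_trepr. Qed.

Lemma pres_addE (P : presentation) n k (x y : term P n k) :
  pres_add (tclass x) (tclass y) = tclass (tadd x y).
Proof. by apply/tclassP/teq_add; apply: teq_trepr. Qed.

Lemma pres_addA (P : presentation) n k : associative (@pres_add P n k).
Proof.
elim/tclass_ind=> x; elim/tclass_ind=> y; elim/tclass_ind=> z.
by rewrite !pres_addE; apply/tclassP/teq_addA.
Qed.

Lemma pres_addC (P : presentation) n k : commutative (@pres_add P n k).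
Proof.
elim/tclass_ind=> x; elim/tclass_ind=> y.
by rewrite !pres_addE; apply/tclassP/teq_addC.
Qed.

Lemma pres_add0 (P : presentation) n k :
  left_id (pres_zero P n k) (@pres_add P n k).
Proof.
by elim/tclass_ind=> x; rewrite pres_addE; apply/tclassP/teq_add0.
Qed.

Lemma pres_addN (P : presentation) n k :
  left_inverse (pres_zero P n k) (@pres_opp P n k) (@pres_add P n k).
Proof.
elim/tclass_ind=> x; rewrite pres_oppE pres_addE.
by apply/tclassP/teq_addN.
Qed.

HB.instance Definition _ (P : presentation) n k :=
  GRing.isZmodule.Build (pres_obj P n k)
    (@pres_addA P n k) (@pres_addC P n k) (@pres_add0 P n k)
    (@pres_addN P n k).

Lemma tclass0 (P : presentation) n k : tclass (tzero : term P n k) = 0.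
Proof. by []. Qed.

Lemma tclassN (P : presentation) n k (x : term P n k) :
  tclass (topp x) = - tclass x.
Proof. by rewrite -pres_oppE. Qed.

Lemma tclassD (P : presentation) n k (x y : term P n k) :
  tclass (tadd x y) = tclass x + tclass y.
Proof. by rewrite -pres_addE. Qed.

Lemma tclass_koszul (P : presentation) n k e (x : term P n k) :
  tclass (tkoszul e x) = koszul e (tclass x).
Proof. by rewrite /tkoszul /koszul; case: ifP => // _; rewrite tclassN. Qed.

Definition pres_d (P : presentation) n k l (h : k = l + 1)
  (x : pres_obj P n k) : pres_obj P n l := tclass (tdiff h (trepr x)).

Lemma pres_dE (P : presentation) n k l (h : k = l + 1) (x : term P n k) :
  pres_d h (tclass x) = tclass (tdiff h x).
Proof. by apply/tclassP/teq_diff/teq_trepr. Qed.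

Lemma zmod_morphismD (U V : zmodType) (f : U -> V) :
  {morph f : x y / x + y} -> zmod_morphism f.
Proof.
move=> fD x y; apply: (addIr (f y)).
by rewrite -fD !subrK.
Qed.

Lemma pres_d_zmod_morphism (P : presentation) n k l (h : k = l + 1) :
  zmod_morphism (@pres_d P n k l h).
Proof.
apply: zmod_morphismD; elim/tclass_ind=> x; elim/tclass_ind=> y.
rewrite -tclassD !pres_dE -tclassD.
by apply/tclassP/teq_diffD.
Qed.

HB.instance Definition _ (P : presentation) n k l (h : k = l + 1) :=
  GRing.isZmodMorphism.Build (pres_obj P n k) (pres_obj P n l)
    (@pres_d P n k l h) (pres_d_zmod_morphism h).

Lemma pres_dd (P : presentation) n (k l m : int)
  (h : k = l + 1) (h' : l = m + 1) (x : pres_obj P n k) :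
  pres_d h' (pres_d h x) = 0.
Proof.
elim/tclass_ind: x => x; rewrite !pres_dE -tclass0.
by apply/tclassP/teq_diff_diff.
Qed.

Definition pres_cx (P : presentation) (n : nat) : complex :=
  @Complex (fun k => pres_obj P n k) (fun k l h => @pres_d P n k l h)
    (@pres_dd P n).

Lemma pres_cx_dE (P : presentation) n k l (h : k = l + 1) (x : term P n k) :
  cx_d h (tclass x : pres_cx P n k) = tclass (tdiff h x).
Proof. exact: pres_dE. Qed.

Definition pres_comp (P : presentation) m n r p q s (i : 'I_m)
  (hr : r.+1 = (m + n)%N) (hs : s = p + q)
  (x : pres_obj P m p) (y : pres_obj P n q) : pres_obj P r s :=
  tclass (tcomp i hr hs (trepr x) (trepr y)).

Lemma pres_compE (P : presentation) m n r p q s (i : 'I_m)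
  (hr : r.+1 = (m + n)%N) (hs : s = p + q)
  (x : term P m p) (y : term P n q) :
  pres_comp i hr hs (tclass x) (tclass y) = tclass (tcomp i hr hs x y).
Proof. by apply/tclassP/teq_comp; apply: teq_trepr. Qed.

Definition presented_operad (P : presentation) : nsOperad.
Proof.
refine (@NsOperad (pres_cx P) (tclass tid) (@pres_comp P) _ _ _ _ _ _ _).
- move=> m n r p q s i hr hs; elim/tclass_ind=> x; elim/tclass_ind=> x'.
  elim/tclass_ind=> y; rewrite -tclassD !pres_compE -tclassD.
  by apply/tclassP/teq_compDl.
- move=> m n r p q s i hr hs; elim/tclass_ind=> x; elim/tclass_ind=> y.
  elim/tclass_ind=> y'; rewrite -tclassD !pres_compE -tclassD.
  by apply/tclassP/teq_compDr.
- move=> n q i hr hs; elim/tclass_ind=> x; rewrite pres_compE.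
  by apply/tclassP/teq_comp1l.
- move=> n q i hr hs; elim/tclass_ind=> x; rewrite pres_compE.
  by apply/tclassP/teq_comp1r.
- move=> m n l r r' w p q t s s' v i j k hr hs hw hv hr' hs' hw' hv'.
  elim/tclass_ind=> x; elim/tclass_ind=> y; elim/tclass_ind=> z hk.
  by rewrite !pres_compE; apply/tclassP/teq_comp_seq.
- move=> m n l r r' w p q t s s' v i k i' k' hr hs hw hv hr' hs' hw' hv'.
  elim/tclass_ind=> x; elim/tclass_ind=> y; elim/tclass_ind=> z hik hi' hk'.
  by rewrite !pres_compE -tclass_koszul; apply/tclassP/teq_comp_par.
- move=> m n r p q s p' q' s' i hr hs hp hq hd hl hr'.
  elim/tclass_ind=> x; elim/tclass_ind=> y.
  rewrite pres_compE !pres_cx_dE !pres_compE -tclass_koszul -tclassD.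
  by apply/tclassP/teq_comp_d.
Defined.

Fixpoint teval (G : signature) (Q : nsOperad)
  (a : forall g : gen G, Q (arity g) (degree g)) n k (x : term G n k) :
  Q n k :=
  match x with
  | tgen g => a g
  | tid => ns_id Q
  | tcomp _ _ _ _ _ _ i hr hs x y => ns_comp i hr hs (teval a x) (teval a y)
  | tdiff _ _ _ h x => cx_d h (teval a x)
  | tzero _ _ => 0
  | topp _ _ x => - teval a x
  | tadd _ _ x y => teval a x + teval a y
  end.

Lemma teval_koszul (G : signature) (Q : nsOperad)
  (a : forall g : gen G, Q (arity g) (degree g)) n k e (x : term G n k) :
  teval a (tkoszul e x) = koszul e (teval a x).
Proof. by rewrite /tkoszul /koszul; case: ifP. Qed.

Lemma teval_teq (P : presentation) (Q : nsOperad)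
  (a : forall g : gen P, Q (arity g) (degree g)) :
  (forall n k (x y : term P n k), pres_rel x y -> teval a x = teval a y) ->
  forall n k (x y : term P n k), teq x y -> teval a x = teval a y.
Proof.
move=> ha n k x y; elim=> {n k x y} //=.
- by move=> n k x y z _ -> _ ->.
- by move=> n k x y _ ->.
- by move=> n k x x' y y' _ -> _ ->.
- by move=> n k l h x y _ ->.
- by move=> m n r p q s i hr hs x x' y y' _ -> _ ->.
- by move=> *; rewrite addrA.
- by move=> *; rewrite addrC.
- by move=> *; rewrite add0r.
- by move=> *; rewrite addNr.
- by move=> *; rewrite raddfD.
- by move=> *; rewrite cx_dd.
- by move=> *; rewrite ns_compDl.
- by move=> *; rewrite ns_compDr.
- by move=> *; rewrite ns_comp1l.
- by move=> *; rewrite ns_comp1r.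
- by move=> *; apply: ns_comp_seq.
- by move=> *; rewrite teval_koszul; apply: ns_comp_par.
- by move=> *; rewrite teval_koszul; apply: ns_comp_d.
Qed.

(* Block permutations.  A permutation s of 'I_m stands for the operation     *)
(* (x_0, ..., x_{m-1}) |-> mu (x_{s 0}, ..., x_{s (m-1)}), i.e., for the     *)
(* right translate of mu by s; with the product of perm.v, in which          *)
(* (s * t) j = t (s j), this is a right action.  The permutation             *)
(* [block_perm hr j s t] is the one such that                                *)
(*   (mu s) o_{s j} (nu t) = (mu o_j nu) (block_perm hr j s t).              *)

(* The position of the input a of mu in the composite of mu with an operation *)
(* of arity n at an input i different from a.                                *)
Definition shift_input (n i a : nat) : nat :=
  if (a < i)%N then a else (a + n).-1.

Definition block_nat (n j : nat) (S T : nat -> nat) (x : nat) : nat :=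
  if (x < j)%N then shift_input n (S j) (S x)
  else if (x < j + n)%N then (S j + T (x - j))%N
  else shift_input n (S j) (S (x - n).+1).

Definition perm_nat n (s : 'S_n) (x : nat) : nat :=
  if insub x is Some i then val (s i : 'I_n) else x.

Lemma perm_natE n (s : 'S_n) (i : 'I_n) : perm_nat s i = s i.
Proof. by rewrite /perm_nat valK. Qed.

Lemma perm_nat_ge n (s : 'S_n) x : (n <= x)%N -> perm_nat s x = x.
Proof. by move=> hx; rewrite /perm_nat insubN // -leqNgt. Qed.

Lemma perm_nat_lt n (s : 'S_n) x : (perm_nat s x < n)%N = (x < n)%N.
Proof.
case: (ltnP x n) => [hx|hx]; last by rewrite perm_nat_ge // ltnNge hx.
by rewrite (perm_natE s (Ordinal hx)) ltn_ord.
Qed.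

Lemma perm_nat_inj n (s : 'S_n) : injective (perm_nat s).
Proof.
move=> x y hxy; have hlt : (x < n)%N = (y < n)%N.
  by rewrite -(perm_nat_lt s x) hxy perm_nat_lt.
case: (ltnP x n) hlt => [hx|hx] /esym hy.
  move: hxy; rewrite (perm_natE s (Ordinal hx)) (perm_natE s (Ordinal hy)).
  by move=> /val_inj /perm_inj /(congr1 val).
by move: hxy; rewrite !perm_nat_ge // leqNgt hy.
Qed.

Lemma perm_nat1 n x : perm_nat (1%g : 'S_n) x = x.
Proof.
case: (ltnP x n) => [hx|hx]; last by rewrite perm_nat_ge.
by rewrite (perm_natE _ (Ordinal hx)) perm1.
Qed.

Lemma perm_natM n (s t : 'S_n) x :
  perm_nat (s * t)%g x = perm_nat t (perm_nat s x).
Proof.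
case: (ltnP x n) => [hx|hx]; last by rewrite !perm_nat_ge.
by rewrite !(perm_natE _ (Ordinal hx)) permM perm_natE.
Qed.

Lemma block_nat_shift n j S T a :
  a != j -> block_nat n j S T (shift_input n j a) = shift_input n (S j) (S a).
Proof.
move=> haj; rewrite /block_nat; case: (ltnP a j) => haj'.
  by rewrite [shift_input n j a]/shift_input haj' haj'.
have -> : shift_input n j a = (a + n).-1 by rewrite /shift_input ltnNge haj'.
have -> : ((a + n).-1 < j)%N = false by lia.
have -> : ((a + n).-1 < j + n)%N = false by lia.
by have -> : ((a + n).-1 - n).+1 = a by lia.
Qed.

Lemma block_nat_in n j S T b :
  (b < n)%N -> block_nat n j S T (j + b) = (S j + T b)%N.
Proof.
move=> hb; rewrite /block_nat.
have -> : (j + b < j)%N = false by lia.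
have -> : (j + b < j + n)%N by lia.
by have -> : (j + b - j = b)%N by lia.
Qed.

Lemma block_natP m n r j x (hr : r.+1 = (m + n)%N) (hj : (j < m)%N)
  (hx : (x < r)%N) :
  (exists a, [/\ (a < m)%N, a != j & x = shift_input n j a])
  \/ (exists b, (b < n)%N /\ x = (j + b)%N).
Proof.
rewrite /shift_input; case: (ltnP x j) => h1.
  by left; exists x; rewrite h1; split=> //; lia.
case: (ltnP x (j + n)) => h2; first by right; exists (x - j)%N; lia.
left; exists (x - n).+1; have -> : ((x - n).+1 < j)%N = false by lia.
by split; lia.
Qed.

Lemma block_nat_lt m n r j (s : 'S_m) (t : 'S_n) x :
  r.+1 = (m + n)%N -> (j < m)%N -> (x < r)%N ->
  (block_nat n j (perm_nat s) (perm_nat t) x < r)%N.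
Proof.
move=> hr hj hx; case: (block_natP hr hj hx) => [[a [ha haj ->]]|[b [hb ->]]].
  rewrite block_nat_shift //.
  have := perm_nat_lt s a; have := perm_nat_lt s j.
  have : perm_nat s a <> perm_nat s j by move/perm_nat_inj; lia.
  by rewrite /shift_input; case: ifP; lia.
rewrite block_nat_in //; have := perm_nat_lt s j; have := perm_nat_lt t b.
by lia.
Qed.

Lemma block_nat_inj m n r j (s : 'S_m) (t : 'S_n) x y :
  r.+1 = (m + n)%N -> (j < m)%N -> (x < r)%N -> (y < r)%N ->
  block_nat n j (perm_nat s) (perm_nat t) x
    = block_nat n j (perm_nat s) (perm_nat t) y -> x = y.
Proof.
move=> hr hj hx hy.
case: (block_natP hr hj hx) => [[a [ha haj ->]]|[b [hb ->]]];
  case: (block_natP hr hj hy) => [[a' [ha' haj' ->]]|[b' [hb' ->]]];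
  rewrite ?block_nat_shift ?block_nat_in //.
- have h1 : perm_nat s a <> perm_nat s j by move/perm_nat_inj; lia.
  have h2 : perm_nat s a' <> perm_nat s j by move/perm_nat_inj; lia.
  move=> h; suff -> : a = a' by [].
  apply: (@perm_nat_inj _ s); move: h; rewrite /shift_input.
  by do 2 case: ifP; lia.
- have h1 : perm_nat s a <> perm_nat s j by move/perm_nat_inj; lia.
  have := perm_nat_lt t b'; rewrite /shift_input hb'.
  by do 2 case: ifP; lia.
- have h1 : perm_nat s a' <> perm_nat s j by move/perm_nat_inj; lia.
  have := perm_nat_lt t b; rewrite /shift_input hb.
  by do 2 case: ifP; lia.
- by move/addnI/perm_nat_inj ->.
Qed.

Definition block_fun m n r (hr : r.+1 = (m + n)%N) (j : 'I_m)
  (s : 'S_m) (t : 'S_n) (x : 'I_r) : 'I_r :=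
  Ordinal (block_nat_lt s t hr (ltn_ord j) (ltn_ord x)).

Lemma block_fun_inj m n r (hr : r.+1 = (m + n)%N) (j : 'I_m)
  (s : 'S_m) (t : 'S_n) : injective (block_fun hr j s t).
Proof.
move=> x y /(congr1 val) /= h; apply/val_inj.
exact: (block_nat_inj hr (ltn_ord j) (ltn_ord x) (ltn_ord y) h).
Qed.

Definition block_perm m n r (hr : r.+1 = (m + n)%N) (j : 'I_m)
  (s : 'S_m) (t : 'S_n) : 'S_r := perm (@block_fun_inj m n r hr j s t).

Lemma block_permE m n r (hr : r.+1 = (m + n)%N) (j : 'I_m)
  (s : 'S_m) (t : 'S_n) (x : 'I_r) :
  block_perm hr j s t x = block_nat n j (perm_nat s) (perm_nat t) x :> nat.
Proof. by rewrite permE. Qed.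

Lemma perm_nat_block m n r (hr : r.+1 = (m + n)%N) (j : 'I_m)
  (s : 'S_m) (t : 'S_n) x :
  (x < r)%N ->
  perm_nat (block_perm hr j s t) x
    = block_nat n j (perm_nat s) (perm_nat t) x.
Proof. by move=> hx; rewrite (perm_natE _ (Ordinal hx)) block_permE. Qed.

Lemma block_nat_ext m n r j S S' T T' x :
  r.+1 = (m + n)%N -> (j < m)%N -> (x < r)%N ->
  (forall a, (a < m)%N -> S a = S' a) -> (forall b, (b < n)%N -> T b = T' b) ->
  block_nat n j S T x = block_nat n j S' T' x.
Proof.
move=> hr hj hx hS hT.
case: (block_natP hr hj hx) => [[a [ha haj ->]]|[b [hb ->]]].
  by rewrite !block_nat_shift // !hS.
by rewrite !block_nat_in // hS // hT.
Qed.

Lemma perm_nat_eq n (s t : 'S_n) :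
  (forall x, (x < n)%N -> perm_nat s x = perm_nat t x) -> s = t.
Proof.
move=> h; apply/permP=> i; apply/val_inj.
by have := h i (ltn_ord i); rewrite !perm_natE.
Qed.

Lemma block_perm1l n (hr : n.+1 = (1 + n)%N) (j : 'I_1) (t : 'S_n) :
  block_perm hr j 1%g t = t.
Proof.
apply: perm_nat_eq => x hx; rewrite perm_nat_block // (ord1 j).
by rewrite -[x in LHS]add0n block_nat_in // perm_nat1.
Qed.

Lemma block_perm1r m (hr : m.+1 = (m + 1)%N) (j : 'I_m) (s : 'S_m) :
  block_perm hr j s 1%g = s.
Proof.
apply: perm_nat_eq => x hx; rewrite perm_nat_block //.
have shift1 a b : a <> b -> shift_input 1 b a = a.
  by rewrite /shift_input; case: ifP; lia.
case: (eqVneq x j) => [->|hxj].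
  have := @block_nat_in 1 j (perm_nat s) (perm_nat (1%g : 'S_1)) 0 isT.
  by rewrite perm_nat1 !addn0.
have := block_nat_shift 1 (perm_nat s) (perm_nat (1%g : 'S_1)) hxj.
by rewrite !shift1 //; [move/perm_nat_inj; lia | lia].
Qed.

Lemma block_permM m n r (hr : r.+1 = (m + n)%N) (j : 'I_m)
  (s s' : 'S_m) (t t' : 'S_n) :
  block_perm hr j (s * s')%g (t * t')%g
    = (block_perm hr j s t * block_perm hr (s j) s' t')%g.
Proof.
apply: perm_nat_eq => x hx; have hj := ltn_ord j.
rewrite perm_natM !perm_nat_block ?block_nat_lt //.
case: (block_natP hr hj hx) => [[a [ha haj ->]]|[b [hb ->]]].
  have h1 : perm_nat s a != perm_nat s j.
    by apply: contra haj => /eqP/perm_nat_inj->.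
  rewrite !block_nat_shift // !perm_natM -(perm_natE s j).
  by rewrite block_nat_shift.
rewrite !block_nat_in // !perm_natM -(perm_natE s j).
by rewrite block_nat_in // perm_nat_lt.
Qed.

Lemma block_perm_seq m n l r r' w
  (hr : r.+1 = (m + n)%N) (hw : w.+1 = (r + l)%N)
  (hr' : r'.+1 = (n + l)%N) (hw' : w.+1 = (m + r')%N)
  (i : 'I_m) (j : 'I_n) (k : 'I_r) (s : 'S_m) (t : 'S_n) (u : 'S_l) :
  k = (i + j)%N :> nat ->
  block_perm hw k (block_perm hr i s t) u
    = block_perm hw' i s (block_perm hr' j t u).
Proof.
move=> hk; have hi := ltn_ord i; have hj := ltn_ord j.
have hkr := ltn_ord k.
apply: perm_nat_eq => x hx; rewrite !perm_nat_block //.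
rewrite (block_nat_ext hw hkr hx (perm_nat_block hr i s t) (fun _ _ => erefl)).
rewrite (block_nat_ext hw' hi hx (fun _ _ => erefl)
  (perm_nat_block hr' j t u)).
set S := perm_nat s; set T := perm_nat t; set U := perm_nat u.
have hT : (T j < n)%N by rewrite perm_nat_lt.
rewrite hk; case: (block_natP hw' hi hx) => [[a [ha hai ->]]|[b [hb ->]]].
  have hSa : S a <> S i by move/perm_nat_inj; lia.
  rewrite block_nat_shift //.
  have -> : shift_input r' i a = shift_input l (i + j) (shift_input n i a).
    by rewrite /shift_input; do !case: ifP; lia.
  rewrite block_nat_shift; last by rewrite /shift_input; case: ifP; lia.
  rewrite block_nat_in // block_nat_shift //.
  by rewrite /shift_input; do !case: ifP; lia.
rewrite block_nat_in //.
case: (block_natP hr' hj hb) => [[c [hc hcj ->]]|[c [hc ->]]].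
  have hTc : T c <> T j by move/perm_nat_inj; lia.
  rewrite block_nat_shift //.
  have -> : (i + shift_input l j c)%N = shift_input l (i + j) (i + c).
    by rewrite /shift_input; do !case: ifP; lia.
  rewrite block_nat_shift; last by lia.
  by rewrite !block_nat_in // /shift_input; do !case: ifP; lia.
by rewrite addnA !block_nat_in // addnA.
Qed.

Lemma block_perm_par m n l r r' w
  (hr : r.+1 = (m + n)%N) (hw : w.+1 = (r + l)%N)
  (hr' : r'.+1 = (m + l)%N) (hw' : w.+1 = (r' + n)%N)
  (i k : 'I_m) (i' : 'I_r') (k' : 'I_r) (s : 'S_m) (t : 'S_n) (u : 'S_l) :
  (i < k)%N -> i' = i :> nat -> k'.+1 = (k + n)%N ->
  block_perm hw k' (block_perm hr i s t) u
    = block_perm hw' i' (block_perm hr' k s u) t.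
Proof.
move=> hik hi' hk'; have hi := ltn_ord i; have hk := ltn_ord k.
apply: perm_nat_eq => x hx; rewrite !perm_nat_block //.
rewrite (block_nat_ext hw (ltn_ord k') hx (perm_nat_block hr i s t)
  (fun _ _ => erefl)).
rewrite (block_nat_ext hw' (ltn_ord i') hx (perm_nat_block hr' k s u)
  (fun _ _ => erefl)).
set S := perm_nat s; set T := perm_nat t; set U := perm_nat u.
have hki : val k != i by rewrite /=; lia.
have hik2 : val i != k by rewrite /=; lia.
have hSik : S k <> S i by move/perm_nat_inj; lia.
have ek' : val k' = shift_input n i k.
  by rewrite /shift_input /=; case: ifP; lia.
have ei' : val i' = shift_input l k i.
  by rewrite /shift_input /=; case: ifP; lia.
rewrite ek' ei'.
case: (block_natP hw (ltn_ord k') hx) => [[a [ha hak ->]]|[b [hb ->]]];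
  last first.
  rewrite ek' block_nat_in // block_nat_shift //.
  have -> : (shift_input n i k + b)%N
     = shift_input n (shift_input l k i) (k + b)%N.
    by rewrite /shift_input; do !case: ifP; lia.
  rewrite block_nat_shift; last by rewrite /shift_input; do !case: ifP; lia.
  rewrite block_nat_in // block_nat_shift //.
  have := perm_nat_lt u b; rewrite -/U.
  by rewrite /shift_input; do !case: ifP; lia.
case: (block_natP hr hi ha) hak => [[c [hc hci ->]]|[c [hc ->]]] hak.
  have hck : c != k.
    by apply: contra hak => /eqP ->; rewrite ek'.
  have hSc : S c <> S k by move/perm_nat_inj; lia.
  have hSc' : S c <> S i by move/perm_nat_inj; lia.
  rewrite ek' block_nat_shift -?ek' // ek' !block_nat_shift //.
  have -> : shift_input l (shift_input n i k) (shift_input n i c)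
     = shift_input n (shift_input l k i) (shift_input l k c).
    by rewrite /shift_input; do !case: ifP; lia.
  rewrite block_nat_shift; last by rewrite /shift_input; do !case: ifP; lia.
  rewrite !block_nat_shift //.
  by rewrite /shift_input; do !case: ifP; lia.
have hTc : (T c < n)%N by rewrite perm_nat_lt.
rewrite ek' block_nat_shift -?ek' // ek' block_nat_in // block_nat_shift //.
have -> : shift_input l (shift_input n i k) (i + c)
   = (shift_input l k i + c)%N.
  by rewrite /shift_input; do !case: ifP; lia.
rewrite block_nat_in // block_nat_shift //.
by rewrite /shift_input; do !case: ifP; lia.
Qed.

(* Symmetric operads in complexes; the symmetric groups act on the right. *)
Record symOperad := SymOperad {
  sym_ns :> nsOperad;
  sym_act : forall n (k : int), 'S_n -> sym_ns n k -> sym_ns n k;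
  sym_actD : forall n k (s : 'S_n) (x y : sym_ns n k),
    sym_act s (x + y) = sym_act s x + sym_act s y;
  sym_act1 : forall n k (x : sym_ns n k), sym_act 1%g x = x;
  sym_actM : forall n k (s t : 'S_n) (x : sym_ns n k),
    sym_act (s * t)%g x = sym_act t (sym_act s x);
  sym_act_d : forall n (k l : int) (h : k = l + 1) (s : 'S_n)
      (x : sym_ns n k),
    cx_d h (sym_act s x) = sym_act s (cx_d h x);
  sym_act_comp : forall m n r (p q d : int) (j : 'I_m)
      (hr : r.+1 = (m + n)%N) (hd : d = p + q) (s : 'S_m) (t : 'S_n)
      (x : sym_ns m p) (y : sym_ns n q),
    ns_comp (s j) hr hd (sym_act s x) (sym_act t y)
      = sym_act (block_perm hr j s t) (ns_comp j hr hd x y)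
}.

Record symMorphism (P Q : symOperad) := SymMorphism {
  sm_map :> forall n : nat, chain_map (P n) (Q n);
  sm_id : sm_map 1%N 0 (ns_id P) = ns_id Q;
  sm_comp : forall m n r (p q d : int) (i : 'I_m) (hr : r.+1 = (m + n)%N)
      (hd : d = p + q) (x : P m p) (y : P n q),
    sm_map r d (ns_comp i hr hd x y)
      = ns_comp i hr hd (sm_map m p x) (sm_map n q y);
  sm_act : forall n k (s : 'S_n) (x : P n k),
    sm_map n k (sym_act s x) = sym_act s (sm_map n k x)
}.

(* The symmetric operad P(n) (x) Z['S_n] associated to a non-symmetric one.  *)
(* The tensor product is realized as the module of functions 'S_n -> P(n),   *)
(* the pure tensor x (x) s being the function [tens x s] with value x at s   *)
(* and 0 elsewhere.  On pure tensors (see [symm_comp_tens])                  *)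
(*   (x (x) s) o_{s j} (y (x) t) = (x o_j y) (x) block_perm hr j s t.        *)

Definition tens (V : zmodType) n (x : V) (s : 'S_n) : {ffun 'S_n -> V} :=
  [ffun u => if u == s then x else 0].

Lemma tensD (V : zmodType) n (s : 'S_n) :
  {morph (fun x : V => tens x s) : x y / x + y}.
Proof.
by move=> x y; apply/ffunP=> u; rewrite !ffunE; case: ifP; rewrite ?addr0.
Qed.

Lemma tens0 (V : zmodType) n (s : 'S_n) : tens (0 : V) s = 0.
Proof. by apply/ffunP=> u; rewrite !ffunE; case: ifP. Qed.

Lemma tensN (V : zmodType) n (s : 'S_n) (x : V) : tens (- x) s = - tens x s.
Proof. by apply/ffunP=> u; rewrite !ffunE; case: ifP; rewrite ?oppr0. Qed.

Lemma tens_koszul (V : zmodType) n (s : 'S_n) e (x : V) :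
  tens (koszul e x) s = koszul e (tens x s).
Proof. by rewrite /koszul; case: ifP => // _; rewrite tensN. Qed.

Lemma tens_sum (V : zmodType) n (f : {ffun 'S_n -> V}) :
  f = \sum_s tens (f s) s.
Proof.
apply/ffunP=> u; rewrite sum_ffunE (bigD1 u) //= ffunE eqxx.
by rewrite big1 ?addr0 // => s hs; rewrite ffunE eq_sym (negPf hs).
Qed.

Lemma tens_ind (V : zmodType) n (Q : {ffun 'S_n -> V} -> Prop) :
  (forall x s, Q (tens x s)) -> (forall f g, Q f -> Q g -> Q (f + g)) ->
  forall f, Q f.
Proof.
move=> ht hD f; rewrite [f]tens_sum; apply: big_ind => //.
by rewrite -(tens0 V 1%g).
Qed.

Definition symm_obj (P : nsOperad) n (k : int) : zmodType :=
  {ffun 'S_n -> P n k}.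

Definition symm_d (P : nsOperad) n k l (h : k = l + 1)
  (f : symm_obj P n k) : symm_obj P n l := [ffun s => cx_d h (f s)].

Lemma symm_d_zmod_morphism (P : nsOperad) n k l (h : k = l + 1) :
  zmod_morphism (@symm_d P n k l h).
Proof. by move=> f g; apply/ffunP=> s; rewrite !ffunE raddfB. Qed.

HB.instance Definition _ (P : nsOperad) n k l (h : k = l + 1) :=
  GRing.isZmodMorphism.Build (symm_obj P n k) (symm_obj P n l)
    (@symm_d P n k l h) (symm_d_zmod_morphism h).

Lemma symm_dd (P : nsOperad) n (k l m : int)
  (h : k = l + 1) (h' : l = m + 1) (f : symm_obj P n k) :
  symm_d h' (symm_d h f) = 0.
Proof. by apply/ffunP=> s; rewrite !ffunE cx_dd. Qed.

Definition symm_cx (P : nsOperad) (n : nat) : complex :=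
  @Complex (fun k => symm_obj P n k) (fun k l h => @symm_d P n k l h)
    (@symm_dd P n).

Definition symm_comp (P : nsOperad) m n r p q d (i : 'I_m)
  (hr : r.+1 = (m + n)%N) (hd : d = p + q)
  (f : symm_obj P m p) (g : symm_obj P n q) : symm_obj P r d :=
  \sum_(s : 'S_m) \sum_(t : 'S_n)
    tens (ns_comp (s^-1%g i) hr hd (f s) (g t)) (block_perm hr (s^-1%g i) s t).

Definition symm_act (P : nsOperad) n k (s : 'S_n) (f : symm_obj P n k) :
  symm_obj P n k := [ffun u : 'S_n => f (u * s^-1)%g].

Lemma symm_d_tens (P : nsOperad) n k l (h : k = l + 1) (x : P n k) (s : 'S_n) :
  symm_d h (tens x s) = tens (cx_d h x) s.
Proof. by apply/ffunP=> u; rewrite !ffunE; case: ifP; rewrite ?raddf0. Qed.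

Lemma symm_act_tens (P : nsOperad) n k (x : P n k) (s t : 'S_n) :
  symm_act s (tens x t) = tens x (t * s)%g.
Proof.
apply/ffunP=> u; rewrite !ffunE; congr (if _ then _ else _).
by rewrite (can2_eq (mulgVK s) (mulgK s)).
Qed.

Lemma symm_actD (P : nsOperad) n k (s : 'S_n) (f g : symm_obj P n k) :
  symm_act s (f + g) = symm_act s f + symm_act s g.
Proof. by apply/ffunP=> u; rewrite !ffunE. Qed.

Lemma ns_comp0l (P : nsOperad) m n r p q d (i : 'I_m)
  (hr : r.+1 = (m + n)%N) (hd : d = p + q) (y : P n q) :
  ns_comp i hr hd (0 : P m p) y = 0.
Proof. by apply: (addIr (ns_comp i hr hd 0 y)); rewrite -ns_compDl !add0r. Qed.

Lemma ns_comp0r (P : nsOperad) m n r p q d (i : 'I_m)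
  (hr : r.+1 = (m + n)%N) (hd : d = p + q) (x : P m p) :
  ns_comp i hr hd x (0 : P n q) = 0.
Proof. by apply: (addIr (ns_comp i hr hd x 0)); rewrite -ns_compDr !add0r. Qed.

Lemma symm_comp_tens (P : nsOperad) m n r p q d (i j : 'I_m)
  (hr : r.+1 = (m + n)%N) (hd : d = p + q)
  (x : P m p) (y : P n q) (s : 'S_m) (t : 'S_n) :
  i = s j ->
  symm_comp i hr hd (tens x s) (tens y t)
    = tens (ns_comp j hr hd x y) (block_perm hr j s t).
Proof.
move=> ->; rewrite /symm_comp (bigD1 s) //= (bigD1 t) //= !ffunE !eqxx permK.
rewrite big1 => [|u hu]; last first.
  by rewrite !ffunE (negPf hu) ns_comp0r tens0.
rewrite big1 ?addr0 // => u hu; rewrite big1 // => v _.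
by rewrite !ffunE (negPf hu) ns_comp0l tens0.
Qed.

Lemma symm_compDl (P : nsOperad) m n r p q d (i : 'I_m)
  (hr : r.+1 = (m + n)%N) (hd : d = p + q)
  (f f' : symm_obj P m p) (g : symm_obj P n q) :
  symm_comp i hr hd (f + f') g
    = symm_comp i hr hd f g + symm_comp i hr hd f' g.
Proof.
rewrite /symm_comp -big_split /=; apply: eq_bigr => s _.
rewrite -big_split /=; apply: eq_bigr => t _.
by rewrite ffunE ns_compDl tensD.
Qed.

Lemma symm_compDr (P : nsOperad) m n r p q d (i : 'I_m)
  (hr : r.+1 = (m + n)%N) (hd : d = p + q)
  (f : symm_obj P m p) (g g' : symm_obj P n q) :
  symm_comp i hr hd f (g + g')
    = symm_comp i hr hd f g + symm_comp i hr hd f g'.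
Proof.
rewrite /symm_comp -big_split /=; apply: eq_bigr => s _.
rewrite -big_split /=; apply: eq_bigr => t _.
by rewrite ffunE ns_compDr tensD.
Qed.

Lemma koszulK (V : zmodType) e : involutive (@koszul V e).
Proof. by move=> x; rewrite /koszul; case: odd; rewrite ?opprK. Qed.

Lemma koszulD (V : zmodType) e (x y : V) :
  koszul e (x + y) = koszul e x + koszul e y.
Proof. by rewrite /koszul; case: ifP => _; rewrite ?opprD. Qed.

Lemma perm_preim n (s : 'S_n) (i : 'I_n) : exists j, i = s j.
Proof. by exists (s^-1%g i); rewrite permKV. Qed.

Lemma block_perm_in m n r (hr : r.+1 = (m + n)%N) (i : 'I_m) (j : 'I_n)
  (k : 'I_r) (s : 'S_m) (t : 'S_n) :
  k = (i + j)%N :> nat -> block_perm hr i s t k = (s i + t j)%N :> nat.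
Proof. by move=> hk; rewrite block_permE hk block_nat_in // !perm_natE. Qed.

Lemma block_perm_shift m n r (hr : r.+1 = (m + n)%N) (i a : 'I_m)
  (k : 'I_r) (s : 'S_m) (t : 'S_n) :
  a != i -> k = shift_input n i a :> nat ->
  block_perm hr i s t k = shift_input n (s i) (s a) :> nat.
Proof.
by move=> hai hk; rewrite block_permE hk block_nat_shift // !perm_natE.
Qed.

Lemma shift_input_lt m n r (i a : 'I_m) (hr : r.+1 = (m + n)%N) :
  a != i -> (shift_input n i a < r)%N.
Proof.
move=> h; have : val a <> val i by move/val_inj/eqP; rewrite (negPf h).
have := ltn_ord a; have := ltn_ord i.
by rewrite /shift_input /=; case: ifP; lia.
Qed.

Lemma symm_comp_seq (P : nsOperad) m n l r r' w (p q t s s' v : int)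
  (i : 'I_m) (j : 'I_n) (k : 'I_r)
  (hr : r.+1 = (m + n)%N) (hs : s = p + q)
  (hw : w.+1 = (r + l)%N) (hv : v = s + t)
  (hr' : r'.+1 = (n + l)%N) (hs' : s' = q + t)
  (hw' : w.+1 = (m + r')%N) (hv' : v = p + s')
  (x : symm_obj P m p) (y : symm_obj P n q) (z : symm_obj P l t) :
  k = (i + j)%N :> nat ->
  symm_comp k hw hv (symm_comp i hr hs x y) z
    = symm_comp i hw' hv' x (symm_comp j hr' hs' y z).
Proof.
move=> hk; elim/tens_ind: x => [x a|x x' hx hx']; last first.
  by rewrite !symm_compDl hx hx'.
elim/tens_ind: y => [y b|y y' hy hy']; last first.
  by rewrite !(symm_compDl, symm_compDr) hy hy'.
elim/tens_ind: z => [z c|z z' hz hz']; last first.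
  by rewrite !symm_compDr hz hz'.
have [i0 hi0] := perm_preim a i; have [j0 hj0] := perm_preim b j.
have hk0 : (i0 + j0 < r)%N by have := ltn_ord i0; have := ltn_ord j0; lia.
pose k0 := Ordinal hk0.
have ek : k0 = (i0 + j0)%N :> nat by [].
have hk1 : k = block_perm hr i0 a b k0.
  by apply: val_inj; rewrite /= (block_perm_in hr a b ek) hk hi0 hj0.
rewrite (symm_comp_tens _ _ _ _ _ hi0) (symm_comp_tens _ _ _ _ _ hj0).
rewrite (symm_comp_tens _ _ _ _ _ hk1) (symm_comp_tens _ _ _ _ _ hi0).
rewrite (ns_comp_seq hr hs hw hv hr' hs' hw' hv' _ _ _ ek).
by rewrite (block_perm_seq hr hw hr' hw' _ _ _ ek).
Qed.

Lemma symm_comp_par (P : nsOperad) m n l r r' w (p q t s s' v : int)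
  (i k : 'I_m) (i' : 'I_r') (k' : 'I_r)
  (hr : r.+1 = (m + n)%N) (hs : s = p + q)
  (hw : w.+1 = (r + l)%N) (hv : v = s + t)
  (hr' : r'.+1 = (m + l)%N) (hs' : s' = p + t)
  (hw' : w.+1 = (r' + n)%N) (hv' : v = s' + q)
  (x : symm_obj P m p) (y : symm_obj P n q) (z : symm_obj P l t) :
  (i < k)%N -> i' = i :> nat -> k'.+1 = (k + n)%N ->
  symm_comp k' hw hv (symm_comp i hr hs x y) z
    = koszul (q * t) (symm_comp i' hw' hv' (symm_comp k hr' hs' x z) y).
Proof.
move=> hik hi' hk'; elim/tens_ind: x => [x a|x x' hx hx']; last first.
  by rewrite !symm_compDl hx hx' koszulD.
elim/tens_ind: y => [y b|y y' hy hy']; last first.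
  by rewrite !(symm_compDl, symm_compDr) hy hy' koszulD.
elim/tens_ind: z => [z c|z z' hz hz']; last first.
  by rewrite !(symm_compDl, symm_compDr) hz hz' koszulD.
have [i0 hi0] := perm_preim a i; have [k0 hk0] := perm_preim a k.
have nik : i0 != k0.
  by apply: contraTneq hik => e; rewrite hi0 hk0 e ltnn.
have nki : k0 != i0 by rewrite eq_sym.
pose k0' := Ordinal (shift_input_lt hr nki).
pose i0' := Ordinal (shift_input_lt hr' nik).
have ek : k' = block_perm hr i0 a b k0'.
  apply: val_inj; rewrite /= (block_perm_shift hr a b nki) // -hi0 -hk0.
  by rewrite /shift_input; case: ifP; lia.
have ei : i' = block_perm hr' k0 a c i0'.
  apply: val_inj; rewrite /= (block_perm_shift hr' a c nik) // -hi0 -hk0.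
  by rewrite /shift_input; case: ifP; lia.
rewrite (symm_comp_tens _ _ _ _ _ hi0) (symm_comp_tens _ _ _ _ _ hk0).
rewrite (symm_comp_tens _ _ _ _ _ ek) (symm_comp_tens _ _ _ _ _ ei).
rewrite -tens_koszul.
case: (ltngtP i0 k0) => [h|h|/val_inj h]; last by case/eqP: (nik).
  have e1 : i0' = i0 :> nat by rewrite /= /shift_input h.
  have e2 : k0'.+1 = (k0 + n)%N.
    by rewrite /= /shift_input; case: ifP; lia.
  rewrite (ns_comp_par hr hs hw hv hr' hs' hw' hv' _ _ _ h e1 e2).
  by rewrite (block_perm_par hr hw hr' hw' _ _ _ h e1 e2).
have e1 : k0' = k0 :> nat by rewrite /= /shift_input h.
have e2 : i0'.+1 = (i0 + l)%N.
  by rewrite /= /shift_input; case: ifP; lia.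
rewrite (ns_comp_par hr' hs' hw' hv' hr hs hw hv _ _ _ h e1 e2).
rewrite (block_perm_par hr' hw' hr hw _ _ _ h e1 e2).
by rewrite [t * q]mulrC koszulK.
Qed.

Definition symm_ns (P : nsOperad) : nsOperad.
Proof.
refine (@NsOperad (symm_cx P) (tens (ns_id P) 1%g) (@symm_comp P)
          (@symm_compDl P) (@symm_compDr P) _ _ (@symm_comp_seq P)
          (@symm_comp_par P) _).
- move=> n q i hr hs; elim/tens_ind=> [x s|x y hx hy]; last first.
    by rewrite symm_compDr hx hy.
  have hi : i = (1%g : 'S_1) i by rewrite perm1.
  by rewrite (symm_comp_tens _ _ _ _ _ hi) ns_comp1l block_perm1l.
- move=> m p i hr hs; elim/tens_ind=> [x s|x y hx hy]; last first.
    by rewrite symm_compDl hx hy.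
  have [j hj] := perm_preim s i.
  by rewrite (symm_comp_tens _ _ _ _ _ hj) ns_comp1r block_perm1r.
- move=> m n r p q s p' q' s' i hr hs hp hq hd hl hr'.
  elim/tens_ind=> [x a|x x' hx hx'] y; last first.
    by rewrite !(symm_compDl, raddfD) /= hx hx' koszulD addrACA.
  elim/tens_ind: y => [y b|y y' hy hy']; last first.
    by rewrite !(symm_compDr, raddfD) /= hy hy' koszulD addrACA.
  have [j hj] := perm_preim a i.
  rewrite /= !symm_d_tens !(symm_comp_tens _ _ _ _ _ hj) symm_d_tens.
  by rewrite (ns_comp_d j hr hs hp hq hd hl hr') tensD tens_koszul.
Defined.

Lemma symm_act_comp (P : nsOperad) m n r (p q d : int) (j : 'I_m)
  (hr : r.+1 = (m + n)%N) (hd : d = p + q) (s : 'S_m) (t : 'S_n)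
  (x : symm_obj P m p) (y : symm_obj P n q) :
  symm_comp (s j) hr hd (symm_act s x) (symm_act t y)
    = symm_act (block_perm hr j s t) (symm_comp j hr hd x y).
Proof.
elim/tens_ind: x => [x a|x x' hx hx']; last first.
  by rewrite !(symm_actD, symm_compDl) hx hx'.
elim/tens_ind: y => [y b|y y' hy hy']; last first.
  by rewrite !(symm_actD, symm_compDr) hy hy'.
have [i hi] := perm_preim a j.
have hj : s j = (a * s)%g i by rewrite permM hi.
rewrite !symm_act_tens (symm_comp_tens _ _ _ _ _ hj).
rewrite (symm_comp_tens _ _ _ _ _ hi) symm_act_tens.
by rewrite block_permM -hi.
Qed.

Definition symmetrization (P : nsOperad) : symOperad.
Proof.
refine (@SymOperad (symm_ns P) (@symm_act P) (@symm_actD P) _ _ _ _).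
- by move=> n k f; apply/ffunP=> u; rewrite ffunE invg1 mulg1.
- by move=> n k s t f; apply/ffunP=> u; rewrite !ffunE invgM mulgA.
- by move=> n k l h s f; apply/ffunP=> u; rewrite !ffunE.
- exact: symm_act_comp.
Defined.

(* The compositions x o_1 y and x o_2 y, with inputs numbered from 1. *)
Definition circ1 (G : signature) (p q : int)
  (x : term G 2%N p) (y : term G 2%N q) : term G 3%N (p + q) :=
  tcomp (ord0 : 'I_2) erefl erefl x y.
Definition circ2 (G : signature) (p q : int)
  (x : term G 2%N p) (y : term G 2%N q) : term G 3%N (p + q) :=
  tcomp (ord_max : 'I_2) erefl erefl x y.

(* TriasL, TriasR and TriasX are the operations written -|, |- and x. *)
Inductive trias_gen := TriasL | TriasR | TriasX.

Definition trias_sig : signature :=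
  @Signature trias_gen (fun _ => 2%N) (fun g => if g is TriasX then 1 else 0).

Definition dashv : term trias_sig 2%N 0 := @tgen trias_sig TriasL.
Definition vdash : term trias_sig 2%N 0 := @tgen trias_sig TriasR.
Definition cross : term trias_sig 2%N 1 := @tgen trias_sig TriasX.

Lemma degree_0N1 : 0 = -1 + 1 :> int. Proof. by []. Qed.
Lemma degree_10 : 1 = 0 + 1 :> int. Proof. by []. Qed.

Inductive trias_rel :
  forall n k, term trias_sig n k -> term trias_sig n k -> Prop :=
| trias_LR : trias_rel (circ1 dashv vdash) (circ2 vdash dashv)
| trias_L2 : trias_rel (circ2 dashv dashv) (circ2 dashv vdash)
| trias_L1 : trias_rel (circ2 dashv vdash) (circ1 dashv dashv)
| trias_R1 : trias_rel (circ1 vdash vdash) (circ1 vdash dashv)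
| trias_R2 : trias_rel (circ1 vdash dashv) (circ2 vdash vdash)
| trias_XR : trias_rel (circ1 cross vdash) (circ2 vdash cross)
| trias_XL : trias_rel (circ2 cross dashv) (circ1 dashv cross)
| trias_XLR : trias_rel (circ1 cross dashv) (circ2 cross vdash)
| trias_RX0 : trias_rel (circ1 vdash cross) tzero
| trias_LX0 : trias_rel (circ2 dashv cross) tzero
| trias_XX : trias_rel (circ1 cross cross) (topp (circ2 cross cross))
| trias_dX : trias_rel (tdiff degree_10 cross) (tadd dashv (topp vdash))
| trias_dR : trias_rel (tdiff degree_0N1 vdash) tzero
| trias_dL : trias_rel (tdiff degree_0N1 dashv) tzero.

Definition trias_pres : presentation := @Presentation trias_sig trias_rel.

Definition TriasNS : nsOperad := presented_operad trias_pres.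

Definition Trias : symOperad := symmetrization TriasNS.

(* The non-unital associative operad: one binary product, associativity as   *)
(* the only relation, zero differential.  As for Trias, no generator or      *)
(* relation involves a permutation of the inputs, so the symmetric operad is *)
(* the symmetrization of the non-symmetric operad with this presentation.    *)

Inductive as_gen := AsMul.

Definition as_sig : signature :=
  @Signature as_gen (fun _ => 2%N) (fun _ => 0).

Definition amul : term as_sig 2%N 0 := @tgen as_sig AsMul.

Inductive as_rel : forall n k, term as_sig n k -> term as_sig n k -> Prop :=
| as_assoc : as_rel (circ1 amul amul) (circ2 amul amul)
| as_d : as_rel (tdiff degree_0N1 amul) tzero.

Definition as_pres : presentation := @Presentation as_sig as_rel.

Definition AsNS : nsOperad := presented_operad as_pres.

Definition As : symOperad := symmetrization AsNS.

Lemma ns_d_id (P : nsOperad) (l : int) (h : 0 = l + 1) :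
  cx_d h (ns_id P) = 0.
Proof.
have hl : l = l + 0 by rewrite addr0.
have hr : l = 0 + l by rewrite add0r.
have := ns_comp_d (ord0 : 'I_1) (erefl : 2%N = (1 + 1)%N)
  (erefl : 0 = 0 + 0 :> int) h h h hl hr (ns_id P) (ns_id P).
rewrite ns_comp1l ns_comp1r /koszul /= ns_comp1l => e.
by apply: (addIr (cx_d h (ns_id P))); rewrite -e add0r.
Qed.

Lemma As_d (n : nat) (k l : int) (h : k = l + 1) (x : As n k) : cx_d h x = 0.
Proof.
suff d0 (y : AsNS n k) : cx_d h y = 0.
  by apply/ffunP=> s; rewrite !ffunE d0.
elim/tclass_ind: y => y; elim: y l h => {n k x}.
- case=> l h; have el : l = -1 by apply: (addIr 1); rewrite -h.
  subst l; rewrite (eq_irrelevance h degree_0N1) pres_cx_dE.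
  by apply/tclassP/teq_rel/as_d.
- by move=> l h; apply: (@ns_d_id AsNS).
- move=> m n r p q d i hr hd x hx y hy l h.
  have hp : p = p - 1 + 1 by rewrite subrK.
  have hq : q = q - 1 + 1 by rewrite subrK.
  have hl : l = p - 1 + q.
    by apply: (addIr 1); rewrite -h hd addrAC subrK.
  have hr' : l = p + (q - 1).
    by apply: (addIr 1); rewrite -h hd -addrA subrK.
  rewrite -pres_compE.
  rewrite (@ns_comp_d AsNS _ _ _ _ _ _ _ _ _ i hr hd hp hq h hl hr').
  rewrite hx hy ns_comp0l ns_comp0r /koszul.
  by case: ifP; rewrite ?oppr0 addr0.
- move=> n k l h x _ m h'.
  by rewrite -(pres_cx_dE h) cx_dd.
- by move=> n k l h; rewrite tclass0 raddf0.
- by move=> n k x hx l h; rewrite tclassN raddfN hx oppr0.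
- by move=> n k x hx y hy l h; rewrite tclassD raddfD hx hy addr0.
Qed.

Definition trias_dashv : Trias 2%N 0 :=
  tens (@tclass trias_pres 2%N 0 dashv) 1%g.
Definition trias_vdash : Trias 2%N 0 :=
  tens (@tclass trias_pres 2%N 0 vdash) 1%g.
Definition trias_cross : Trias 2%N 1 :=
  tens (@tclass trias_pres 2%N 1 cross) 1%g.
Definition as_mul : As 2%N 0 :=
  tens (@tclass as_pres 2%N 0 amul) 1%g.

(* Main.v *)
From HB Require Import structures.
Require Import Defs.
From mathcomp Require Import all_boot all_order perm all_algebra.
From mathcomp Require Import boolp zify.

Set Implicit Arguments.
Unset Strict Implicit.
Unset Printing Implicit Defensive.

Import GRing.Theory.
Local Open Scope ring_scope.
Local Open Scope quotient_scope.

(** Let phi be the morphism from the non-symmetric operad of trialgebras to that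
    of associative algebras given in the statement. The operation |- is an
    associative cycle, so sending the product to |- defines a morphism s in the
    other direction, with phi s = id. Hence it suffices to find an operator h of
    degree 1 with dh + hd = id - e, where e = s phi ([vdash_proj]).

    In arity n the trialgebra operad is the chain complex of the simplex with
    vertices 1, ..., n: in arity 2, -| is the vertex 1, |- the vertex 2 and x
    the edge between them. The endomorphism e collapses the simplex onto its
    last vertex, and h is the cone with that apex. The cone is compatible with
    compositions in the following sense:
      h (u o_i v) = h u o_i e v + (-1)^|u| u o_i h v
      h (u o_i v) = h u o_i v
    where i is the last input of u in the first case and another input in the
    second, and moreover h(-|) = x and h(|-) = h(x) = 0. These formulas
    determine h on every operation, and the proof takes them as its definition.

    That they are consistent is expressed by a dg operad: the pairs (u, a) of an
    operation u and a possible value a of h u, with the differential and the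
    compositions dictated by dh + hd = id - e and by the formulas above, form an
    operad ([homotopy_operad]), in which (-|, x), (|-, 0) and (x, 0) satisfy the
    relations of trialgebras ([TriasHtpy_laws]). The resulting morphism sends u
    to (u, h u). The axioms of the operad of pairs hold because
      e u o_i v = e u o_i e v  if i is not the last input of u
    ([vdash_proj_absorb]): e u is a composite of copies of |-, so v is grafted
    on the left of some |-, where the relations identify -| with |- and
    annihilate x.

    The symmetric operads are sums of copies of the non-symmetric ones, indexed
    by permutations, so the retraction and the homotopy extend to them
    componentwise ([quasi_iso_symm]). *)

(** * Signs and compositions *)

Lemma ns_compNl (P : nsOperad) m n r p q s (i : 'I_m) (hr : r.+1 = (m + n)%N)
  (hs : s = p + q) (x : P m p) (y : P n q) :
  ns_comp i hr hs (- x) y = - ns_comp i hr hs x y.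
Proof.
by apply: (addrI (ns_comp i hr hs x y)); rewrite -ns_compDl !subrr ns_comp0l.
Qed.

Lemma ns_compNr (P : nsOperad) m n r p q s (i : 'I_m) (hr : r.+1 = (m + n)%N)
  (hs : s = p + q) (x : P m p) (y : P n q) :
  ns_comp i hr hs x (- y) = - ns_comp i hr hs x y.
Proof.
by apply: (addrI (ns_comp i hr hs x y)); rewrite -ns_compDr !subrr ns_comp0r.
Qed.

Lemma ns_comp_irr (P : nsOperad) m n r p q s (i i' : 'I_m)
  (hr hr' : r.+1 = (m + n)%N) (hs hs' : s = p + q) (x : P m p) (y : P n q) :
  i = i' :> nat -> ns_comp i hr hs x y = ns_comp i' hr' hs' x y.
Proof.
by move=> /val_inj ->; rewrite (eq_irrelevance hr hr') (eq_irrelevance hs hs').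
Qed.

Lemma subrACA (V : zmodType) (x y z t : V) :
  x - y - (z - t) = x - z - (y - t).
Proof. by rewrite !opprD !opprK addrACA. Qed.

Lemma cx_d_koszul (C : complex) k l (h : k = l + 1) e (x : C k) :
  cx_d h (koszul e x) = koszul e (cx_d h x).
Proof. by rewrite /koszul; case: ifP => // _; rewrite raddfN. Qed.

(** The bookkeeping of the Leibniz rule at a last input ([htpy_comp_d]): y
    stands for u o e v, which the contributions of u and v have in common. *)
Lemma subr_regroup (V : zmodType) (a b c d x y z : V) :
  a - b - (c - d + (z - x)) = y - b - c + x + (d + (a - y - z)).
Proof.
rewrite !opprD !opprK !addrA [RHS](ACl (6*2*3*5*8*4*(1*7))) /=.
by rewrite subrr addr0.
Qed.

Lemma odd_abszD (a b : int) :
  odd (absz (a + b)) = odd (absz a) (+) odd (absz b).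
Proof. lia. Qed.

Lemma koszul_add (V : zmodType) (a b : int) (x : V) :
  koszul (a + b) x = koszul a (koszul b x).
Proof.
by rewrite /koszul odd_abszD; do 2 case: odd; rewrite /= ?opprK.
Qed.

Lemma koszulN (V : zmodType) e (x : V) : koszul e (- x) = - koszul e x.
Proof. by rewrite /koszul; case: ifP. Qed.

Lemma koszul1 (V : zmodType) (x : V) : koszul 1 x = - x.
Proof. by []. Qed.

Lemma ns_comp_koszull (P : nsOperad) m n r p q s (i : 'I_m)
  (hr : r.+1 = (m + n)%N) (hs : s = p + q) e (x : P m p) (y : P n q) :
  ns_comp i hr hs (koszul e x) y = koszul e (ns_comp i hr hs x y).
Proof. by rewrite /koszul; case: ifP => // _; rewrite ns_compNl. Qed.

Lemma ns_comp_koszulr (P : nsOperad) m n r p q s (i : 'I_m)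
  (hr : r.+1 = (m + n)%N) (hs : s = p + q) e (x : P m p) (y : P n q) :
  ns_comp i hr hs x (koszul e y) = koszul e (ns_comp i hr hs x y).
Proof. by rewrite /koszul; case: ifP => // _; rewrite ns_compNr. Qed.

(** * Morphisms of non-symmetric operads *)

Record nsMorphism (P Q : nsOperad) := NsMorphism {
  nm_map :> forall n : nat, chain_map (P n) (Q n);
  nm_id : nm_map 1%N 0 (ns_id P) = ns_id Q;
  nm_comp : forall m n r (p q d : int) (i : 'I_m) (hr : r.+1 = (m + n)%N)
      (hd : d = p + q) (x : P m p) (y : P n q),
    nm_map r d (ns_comp i hr hd x y)
      = ns_comp i hr hd (nm_map m p x) (nm_map n q y)
}.

Definition chain_id (C : complex) : chain_map C C :=
  @ChainMap C C (fun k => idfun) (fun k l h x => erefl).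

Definition chain_comp (C D E : complex) (g : chain_map D E)
  (f : chain_map C D) : chain_map C E.
Proof.
refine (@ChainMap C E (fun k => g k \o f k : {additive C k -> E k}) _).
by move=> k l h x /=; rewrite !cm_d.
Defined.

Definition nm_identity (P : nsOperad) : nsMorphism P P :=
  @NsMorphism P P (fun n => chain_id (P n)) erefl
    (fun m n r p q d i hr hd x y => erefl).

Definition nm_compose (P Q R : nsOperad) (g : nsMorphism Q R)
  (f : nsMorphism P Q) : nsMorphism P R.
Proof.
refine (@NsMorphism P R (fun n => chain_comp (g n) (f n)) _ _).
- by rewrite /= !nm_id.
- by move=> m n r p q d i hr hd x y /=; rewrite !nm_comp.
Defined.

(** * Presented operads *)

Section Presented.
Variable P : presentation.

(** The elements obtained from the generators by the operations of a dg operad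
    exhaust a presented operad, since every class is the class of a term. *)
Lemma pres_ind (Q : forall n k, presented_operad P n k -> Prop) :
  (forall g, Q _ _ (tclass (tgen g))) ->
  Q _ _ (ns_id (presented_operad P)) ->
  (forall m n r p q s (i : 'I_m) (hr : r.+1 = (m + n)%N) (hs : s = p + q) x y,
     Q m p x -> Q n q y -> Q r s (ns_comp i hr hs x y)) ->
  (forall n k l (h : k = l + 1) x, Q n k x -> Q n l (cx_d h x)) ->
  (forall n k, Q n k 0) -> (forall n k x, Q n k x -> Q n k (- x)) ->
  (forall n k x y, Q n k x -> Q n k y -> Q n k (x + y)) ->
  forall n k x, Q n k x.
Proof.
move=> hg hi hc hd h0 hN hD n k; elim/tclass_ind; elim=> {n k} //.
- move=> m n r p q s i hr hs x hx y hy; rewrite -pres_compE.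
  exact: (hc _ _ _ _ _ _ i hr hs).
- by move=> n k l h x hx; rewrite -pres_cx_dE; apply: hd.
- by move=> n k x hx; rewrite tclassN; apply: hN.
- by move=> n k x hx y hy; rewrite tclassD; apply: hD.
Qed.

Section Eval.
Variables (Q : nsOperad) (a : forall g : gen P, Q (arity g) (degree g)).
Hypothesis ha : forall n k (x y : term P n k), pres_rel x y ->
  teval a x = teval a y.

Definition pres_eval n k (x : presented_operad P n k) : Q n k :=
  teval a (trepr x).

Lemma pres_evalE n k (x : term P n k) : pres_eval (tclass x) = teval a x.
Proof. exact: (teval_teq ha (teq_trepr x)). Qed.

Lemma pres_eval_zmod_morphism n k : zmod_morphism (@pres_eval n k).
Proof.
apply: zmod_morphismD; elim/tclass_ind=> x; elim/tclass_ind=> y.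
by rewrite -tclassD !pres_evalE.
Qed.

HB.instance Definition _ n k :=
  GRing.isZmodMorphism.Build (presented_operad P n k) (Q n k)
    (@pres_eval n k) (@pres_eval_zmod_morphism n k).

Lemma pres_eval_d n k l (h : k = l + 1) (x : presented_operad P n k) :
  pres_eval (cx_d h x) = cx_d h (pres_eval x).
Proof. by elim/tclass_ind: x => x; rewrite pres_cx_dE !pres_evalE. Qed.

(** The universal property of a presentation: values of the generators that
    satisfy the relations extend to a morphism. *)
Definition pres_morphism : nsMorphism (presented_operad P) Q.
Proof.
refine (@NsMorphism (presented_operad P) Q
  (fun n => @ChainMap (presented_operad P n) (Q n)
    (fun k => (@pres_eval n k : {additive _ -> _})) (@pres_eval_d n)) _ _).
- exact: pres_evalE.
- move=> m n r p q d i hr hd; elim/tclass_ind=> x; elim/tclass_ind=> y /=.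
  by rewrite pres_compE !pres_evalE.
Defined.

Lemma pres_morphism_gen (g : gen P) :
  pres_morphism (arity g) (degree g) (tclass (tgen g)) = a g.
Proof. exact: pres_evalE. Qed.

End Eval.
End Presented.

Lemma pres_morphism_eq (P : presentation) (Q : nsOperad)
  (f g : nsMorphism (presented_operad P) Q) :
  (forall a : gen P, f _ _ (tclass (tgen a)) = g _ _ (tclass (tgen a))) ->
  forall n k x, f n k x = g n k x.
Proof.
move=> h; apply: (pres_ind (Q := fun n k x => f n k x = g n k x)) => //.
- by rewrite !nm_id.
- by move=> m n r p q s i hr hs x y hx hy; rewrite !nm_comp hx hy.
- by move=> n k l hd x hx; rewrite !cm_d hx.
- by move=> n k; rewrite !raddf0.
- by move=> n k x hx; rewrite !raddfN hx.
- by move=> n k x y hx hy; rewrite !raddfD hx hy.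
Qed.

(** A composite of arity 0 has its second factor in arity 0, and the identity
    has arity 1. *)
Lemma presented_arity0 (P : presentation) :
  (forall g : gen P, (0 < arity g)%N) ->
  forall k (x : presented_operad P 0%N k), x = 0.
Proof.
move=> hP; suff h n k (x : presented_operad P n k) : n = 0%N -> x = 0.
  by move=> k x; apply: h.
apply: (pres_ind (Q := fun n k x => n = 0%N -> x = 0)) n k x => //.
- by move=> g hg; move: (hP g); rewrite [X in (0 < X)%N]hg.
- move=> m n r p q s i hr hs x y hx hy r0.
  have hi := ltn_ord i; rewrite hy ?ns_comp0r //; lia.
- by move=> n k l h x hx n0; rewrite hx ?raddf0.
- by move=> n k x hx n0; rewrite hx ?oppr0.
- by move=> n k x y hx hy n0; rewrite hx ?hy ?addr0.
Qed.

(** * The operad of homotopies from the identity *)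

Section HomotopyOperad.
(* A pair (x, a) stands for an operation x together with a candidate a for the
   value at x of a homotopy h with dh + hd = id - e. *)
Variables (P : nsOperad) (e : nsMorphism P P).
Hypothesis arity0 : forall k (x : P 0%N k), x = 0.
Hypothesis absorb : forall m n r (p q s : int) (i : 'I_m)
  (hr : r.+1 = (m + n)%N) (hs : s = p + q)
  (x : P m p) (y : P n q), (i.+1 < m)%N ->
  ns_comp i hr hs (e m p x) y = ns_comp i hr hs (e m p x) (e n q y).

Definition htpy_obj n k : zmodType := (P n k * P n (k + 1)%R)%type.

(** The second component is the value of h at dx forced by
    h d x = x - e x - d h x. *)
Definition htpy_d n k l (h : k = l + 1) (x : htpy_obj n k) : htpy_obj n l :=
  (cx_d h x.1,
   ecast z (P n z) h (x.1 - e n k x.1) - cx_d (congr1 (+%R^~ 1) h) x.2).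

Lemma htpy_d_zmod_morphism n k l (h : k = l + 1) :
  zmod_morphism (@htpy_d n k l h).
Proof.
subst k => x y; congr pair; first exact: raddfB.
rewrite /= !(raddfB (e n _)) !(raddfB (cx_d _)) [x.1 - y.1 - _]subrACA.
exact: subrACA.
Qed.

HB.instance Definition _ n k l (h : k = l + 1) :=
  GRing.isZmodMorphism.Build (htpy_obj n k) (htpy_obj n l) (@htpy_d n k l h)
    (htpy_d_zmod_morphism h).

Lemma htpy_dd n (k l m : int) (h : k = l + 1) (h' : l = m + 1)
  (x : htpy_obj n k) :
  htpy_d h' (htpy_d h x) = 0.
Proof.
subst k; subst l; congr pair => /=; first exact: cx_dd.
by rewrite !(raddfB (cx_d _)) cx_dd subr0 cm_d subrr.
Qed.

Definition htpy_cx n : complex :=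
  @Complex (htpy_obj n) (fun k l h => @htpy_d n k l h) (@htpy_dd n).

Lemma succ_degl (s p q : int) : s = p + q -> s + 1 = (p + 1) + q.
Proof. by move=> ->; rewrite addrAC. Qed.

Lemma succ_degr (s p q : int) : s = p + q -> s + 1 = p + (q + 1).
Proof. by move=> ->; rewrite addrA. Qed.

(** Only the last input sees the homotopy of the grafted operation: elsewhere
    the cone with apex the last vertex acts on x alone. *)
Definition htpy_comp m n r p q s (i : 'I_m) (hr : r.+1 = (m + n)%N)
  (hs : s = p + q) (x : htpy_obj m p) (y : htpy_obj n q) : htpy_obj r s :=
  (ns_comp i hr hs x.1 y.1,
   if i.+1 == m then
     ns_comp i hr (succ_degl hs) x.2 (e n q y.1)
     + koszul p (ns_comp i hr (succ_degr hs) x.1 y.2)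
   else ns_comp i hr (succ_degl hs) x.2 y.1).

Lemma htpy_compDl m n r p q s (i : 'I_m) (hr : r.+1 = (m + n)%N)
  (hs : s = p + q) (x x' : htpy_obj m p) (y : htpy_obj n q) :
  htpy_comp i hr hs (x + x') y = htpy_comp i hr hs x y + htpy_comp i hr hs x' y.
Proof.
congr pair => /=; first exact: ns_compDl.
by case: ifP => _; rewrite !ns_compDl ?koszulD // addrACA.
Qed.

Lemma htpy_compDr m n r p q s (i : 'I_m) (hr : r.+1 = (m + n)%N)
  (hs : s = p + q) (x : htpy_obj m p) (y y' : htpy_obj n q) :
  htpy_comp i hr hs x (y + y') = htpy_comp i hr hs x y + htpy_comp i hr hs x y'.
Proof.
congr pair => /=; first exact: ns_compDr.
by case: ifP => _; rewrite ?raddfD !ns_compDr ?koszulD // addrACA.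
Qed.

Lemma htpy_comp1l n q (i : 'I_1) (hr : n.+1 = (1 + n)%N) (hs : q = 0 + q)
  (x : htpy_obj n q) : htpy_comp i hr hs (ns_id P, 0) x = x.
Proof.
case: x => x a; congr pair; rewrite /= ?ns_comp1l // ord1 eqxx.
by rewrite ns_comp0l add0r.
Qed.

Lemma htpy_comp1r m p (i : 'I_m) (hr : m.+1 = (m + 1)%N) (hs : p = p + 0)
  (x : htpy_obj m p) : htpy_comp i hr hs x (ns_id P, 0) = x.
Proof.
case: x => x a; congr pair; rewrite /= ?ns_comp1r //.
rewrite ns_comp0r nm_id ns_comp1r.
by rewrite /koszul; case: ifP => _ //; case: ifP => _; rewrite ?oppr0 addr0.
Qed.

(** The absorption hypothesis is what makes the two sides agree when y is
    grafted at the last input of x and z at another input of y. *)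
Lemma htpy_comp_seq m n l r r' w (p q t s s' v : int)
  (i : 'I_m) (j : 'I_n) (k : 'I_r)
  (hr : r.+1 = (m + n)%N) (hs : s = p + q)
  (hw : w.+1 = (r + l)%N) (hv : v = s + t)
  (hr' : r'.+1 = (n + l)%N) (hs' : s' = q + t)
  (hw' : w.+1 = (m + r')%N) (hv' : v = p + s')
  (x : htpy_obj m p) (y : htpy_obj n q) (z : htpy_obj l t) :
  k = (i + j)%N :> nat ->
  htpy_comp k hw hv (htpy_comp i hr hs x y) z
    = htpy_comp i hw' hv' x (htpy_comp j hr' hs' y z).
Proof.
move=> hk; have hi := ltn_ord i; have hj := ltn_ord j.
congr pair => /=.
  exact: ns_comp_seq.
have seq := ns_comp_seq hr _ hw _ hr' _ hw' _ _ _ _ hk.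
case: (eqVneq i.+1 m) => him; last first.
  have -> : (k.+1 == r) = false by lia.
  exact: seq.
case: (eqVneq j.+1 n) => hjn; last first.
  have -> : (k.+1 == r) = false by lia.
  rewrite nm_comp ns_compDl ns_comp_koszull.
  congr (_ + koszul _ _); last exact: seq.
  rewrite -absorb; last by lia.
  exact: seq.
have -> : (k.+1 == r) by lia.
rewrite ns_compDl ns_comp_koszull nm_comp ns_compDr koszulD ns_comp_koszulr.
rewrite -addrA; congr (_ + _); first exact: seq.
congr (koszul _ _ + _); first exact: seq.
rewrite [s in koszul s _]hs koszul_add; do 2 congr koszul; exact: seq.
Qed.

(** The inputs of x receiving y and z are distinct, so the left one is not
    the last and at most z contributes its homotopy. If z had arity 0, the left
    input could become the last one; but then z = 0. *)
Lemma htpy_comp_par m n l r r' w (p q t s s' v : int)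
  (i k : 'I_m) (i' : 'I_r') (k' : 'I_r)
  (hr : r.+1 = (m + n)%N) (hs : s = p + q)
  (hw : w.+1 = (r + l)%N) (hv : v = s + t)
  (hr' : r'.+1 = (m + l)%N) (hs' : s' = p + t)
  (hw' : w.+1 = (r' + n)%N) (hv' : v = s' + q)
  (x : htpy_obj m p) (y : htpy_obj n q) (z : htpy_obj l t) :
  (i < k)%N -> i' = i :> nat -> k'.+1 = (k + n)%N ->
  htpy_comp k' hw hv (htpy_comp i hr hs x y) z
    = koszul (q * t) (htpy_comp i' hw' hv' (htpy_comp k hr' hs' x z) y).
Proof.
move=> hik hi' hk'; have hi := ltn_ord i; have hk := ltn_ord k.
have -> u (a : P w u) (b : P w (u + 1)) f :
    koszul f ((a, b) : htpy_obj w u) = (koszul f a, koszul f b).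
  by rewrite /koszul; case: ifP.
have par := ns_comp_par hr _ hw _ hr' _ hw' _ _ _ _ hik hi' hk'.
congr pair => /=; first exact: par.
have -> : (i.+1 == m) = false by lia.
have -> : (k'.+1 == r) = (k.+1 == m) by lia.
case: l hw hr' z par => [|l] hw hr' z par.
  (* here the two sides may follow different cases of htpy_comp *)
  rewrite (arity0 z.1) (arity0 z.2) raddf0 !ns_comp0r ?(ns_comp0r, ns_comp0l).
  rewrite /koszul; do !case: ifP => _;
    by rewrite ?(ns_comp0l, ns_comp0r, oppr0, addr0).
have -> : (i'.+1 == r') = false by lia.
case: eqP => _; last exact: par.
rewrite ns_compDl koszulD; congr (_ + _); first exact: par.
rewrite ns_comp_koszull.
rewrite (par P p q (t + 1) _ _ _ _ _ (succ_degr hs') (succ_degl hv')).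
rewrite hs mulrDr mulr1 !koszul_add.
rewrite [koszul q (koszul (_ * _) _)]/koszul.
by rewrite /koszul; do !case: ifP; rewrite ?opprK.
Qed.

(** At an input other than the last, the second components differ by
    e x o y - e x o e y, which vanishes by absorption. *)
Lemma htpy_comp_d m n r (p q s p' q' s' : int) (i : 'I_m)
  (hr : r.+1 = (m + n)%N) (hs : s = p + q)
  (hp : p = p' + 1) (hq : q = q' + 1) (h : s = s' + 1)
  (hl : s' = p' + q) (hr' : s' = p + q') (x : htpy_obj m p) (y : htpy_obj n q) :
  htpy_d h (htpy_comp i hr hs x y)
    = htpy_comp i hr hl (htpy_d hp x) y
      + koszul p (htpy_comp i hr hr' x (htpy_d hq y)).
Proof.
revert hs; subst p q s => hs.
have -> u (a : P r u) (b : P r (u + 1)) f :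
    koszul f ((a, b) : htpy_obj r u) = (koszul f a, koszul f b).
  by rewrite /koszul; case: ifP.
have koszulS (V : zmodType) (a : V) : koszul (p' + 1) a = - koszul p' a.
  by rewrite koszul_add koszul1 koszulN.
congr pair => /=; first exact: ns_comp_d.
rewrite (eq_irrelevance (succ_degl hl) hs).
case: eqP => hi.
  rewrite (raddfD (cx_d _)) /= nm_comp cx_d_koszul.
  rewrite (ns_comp_d i hr _ erefl erefl _ hs (succ_degl hr')).
  rewrite (ns_comp_d i hr _ erefl erefl _ (succ_degr hl) hs).
  rewrite cm_d !ns_compDl !ns_compNl !ns_compDr !ns_compNr.
  rewrite (eq_irrelevance (succ_degr hr') hs).
  rewrite (koszul_add (p' + 1)) koszul1 koszulN !koszulD !koszulK.
  rewrite [koszul (p' + 1) (ns_comp i hr (succ_degr hl) _ _)]koszulS.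
  rewrite [- koszul p' _ + _]addrC.
  exact: subr_regroup.
rewrite (ns_comp_d i hr _ erefl erefl _ hs (succ_degl hr')).
rewrite nm_comp -absorb; last by have := ltn_ord i; lia.
rewrite !ns_compDl !ns_compNl (koszul_add (p' + 1)) koszul1 koszulN.
by rewrite opprD opprK addrA.
Qed.

Definition homotopy_operad : nsOperad :=
  @NsOperad htpy_cx ((ns_id P, 0) : htpy_obj 1%N 0) htpy_comp
    htpy_compDl htpy_compDr htpy_comp1l htpy_comp1r htpy_comp_seq
    htpy_comp_par htpy_comp_d.

Definition homotopy_fst : nsMorphism homotopy_operad P :=
  @NsMorphism homotopy_operad P
    (fun n => @ChainMap (htpy_cx n) (P n)
       (fun k => (fst : {additive htpy_obj n k -> P n k}))
       (fun k l h x => erefl))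
    erefl (fun m n r p q d i hr hd x y => erefl).
End HomotopyOperad.

(** * The retraction of Trias onto As *)

Definition opL : TriasNS 2%N 0 := @tclass trias_pres 2%N 0 dashv.
Definition opR : TriasNS 2%N 0 := @tclass trias_pres 2%N 0 vdash.
Definition opX : TriasNS 2%N 1 := @tclass trias_pres 2%N 1 cross.
Definition opM : AsNS 2%N 0 := @tclass as_pres 2%N 0 amul.

Lemma AsNS_d n k l (h : k = l + 1) (x : AsNS n k) : cx_d h x = 0.
Proof.
have /ffunP/(_ 1%g) := As_d h (tens x 1%g : As n k).
by rewrite !ffunE eqxx.
Qed.

Definition ncirc1 (Q : nsOperad) (p q : int) (x : Q 2%N p) (y : Q 2%N q) :
  Q 3%N (p + q) := ns_comp (ord0 : 'I_2) erefl erefl x y.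
Definition ncirc2 (Q : nsOperad) (p q : int) (x : Q 2%N p) (y : Q 2%N q) :
  Q 3%N (p + q) := ns_comp (ord_max : 'I_2) erefl erefl x y.

Section TriasUniversal.
Variables (Q : nsOperad) (l r : Q 2%N 0) (c : Q 2%N 1).

Definition trias_val (g : gen trias_pres) :
    Q (@arity trias_sig g) (@degree trias_sig g) :=
  match g with TriasL => l | TriasR => r | TriasX => c end.

(** The defining relations of trialgebras for operations l, r and c of an
    arbitrary operad, in the roles of -|, |- and x. *)
Record trias_laws : Prop := TriasLaws {
  law_LR : ncirc1 l r = ncirc2 r l;
  law_L2 : ncirc2 l l = ncirc2 l r;
  law_L1 : ncirc2 l r = ncirc1 l l;
  law_R1 : ncirc1 r r = ncirc1 r l;
  law_R2 : ncirc1 r l = ncirc2 r r;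
  law_XR : ncirc1 c r = ncirc2 r c;
  law_XL : ncirc2 c l = ncirc1 l c;
  law_XLR : ncirc1 c l = ncirc2 c r;
  law_RX0 : ncirc1 r c = 0;
  law_LX0 : ncirc2 l c = 0;
  law_XX : ncirc1 c c = - (ncirc2 c c);
  law_dX : cx_d degree_10 c = l - r;
  law_dR : cx_d degree_0N1 r = 0;
  law_dL : cx_d degree_0N1 l = 0
}.

Lemma trias_val_rel : trias_laws -> forall n k (x y : term trias_pres n k),
  pres_rel x y -> teval trias_val x = teval trias_val y.
Proof.
case=> *.
by match goal with h : pres_rel _ _ |- _ => case: h end.
Qed.
End TriasUniversal.

Lemma TriasNS_laws : trias_laws opL opR opX.
Proof.
have comp m n r p q s (i : 'I_m) hr hs x y :
  ns_comp i hr hs (tclass x : TriasNS m p) (tclass y : TriasNS n q)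
  = tclass (tcomp i hr hs x y) :> TriasNS r s := pres_compE i hr hs x y.
split; rewrite /ncirc1 /ncirc2 /opL /opR /opX ?comp ?pres_cx_dE;
  rewrite -?tclass0 -?tclassN -?tclassD;
  apply/tclassP/teq_rel; constructor.
Qed.

Lemma AsNS_assoc : ncirc1 opM opM = ncirc2 opM opM.
Proof.
rewrite /ncirc1 /ncirc2 /= /opM !pres_compE.
exact/tclassP/teq_rel/as_assoc.
Qed.

Section AsUniversal.
Variables (Q : nsOperad) (m : Q 2%N 0).
Definition as_val (g : gen as_pres) : Q (@arity as_sig g) (@degree as_sig g) :=
  match g with AsMul => m end.

Lemma as_val_rel : ncirc1 m m = ncirc2 m m -> cx_d degree_0N1 m = 0 ->
  forall n k (x y : term as_pres n k),
  pres_rel x y -> teval as_val x = teval as_val y.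
Proof.
move=> *.
by match goal with h : pres_rel _ _ |- _ => case: h end.
Qed.
End AsUniversal.

Lemma AsNS_laws : trias_laws opM opM (0 : AsNS 2%N 1).
Proof.
split; rewrite /ncirc1 /ncirc2 ?(ns_comp0l, ns_comp0r, oppr0, raddf0, subrr) //;
  by rewrite ?AsNS_d //; exact: AsNS_assoc || exact: esym AsNS_assoc.
Qed.

Lemma vdash_assoc : ncirc1 opR opR = ncirc2 opR opR.
Proof. by rewrite (law_R1 TriasNS_laws) (law_R2 TriasNS_laws). Qed.

Definition trias_to_as : nsMorphism TriasNS AsNS :=
  pres_morphism (trias_val_rel AsNS_laws).

Definition as_to_trias : nsMorphism AsNS TriasNS :=
  pres_morphism (as_val_rel vdash_assoc (law_dR TriasNS_laws)).

Lemma trias_to_asE :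
  [/\ trias_to_as 2%N 0 opL = opM, trias_to_as 2%N 0 opR = opM
    & trias_to_as 2%N 1 opX = 0].
Proof.
split.
- exact: (pres_morphism_gen (trias_val_rel AsNS_laws) TriasL).
- exact: (pres_morphism_gen (trias_val_rel AsNS_laws) TriasR).
- exact: (pres_morphism_gen (trias_val_rel AsNS_laws) TriasX).
Qed.

Lemma as_to_triasE : as_to_trias 2%N 0 opM = opR.
Proof.
exact: (pres_morphism_gen (as_val_rel vdash_assoc (law_dR TriasNS_laws)) AsMul).
Qed.

Lemma as_to_triasK n k (x : AsNS n k) :
  trias_to_as n k (as_to_trias n k x) = x.
Proof.
apply: (pres_morphism_eq (f := nm_compose trias_to_as as_to_trias)
  (g := nm_identity AsNS)); case=> /=.
by rewrite as_to_triasE; case: trias_to_asE.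
Qed.

Definition vdash_proj : nsMorphism TriasNS TriasNS :=
  nm_compose as_to_trias trias_to_as.

Lemma vdash_proj_as n k (x : AsNS n k) :
  vdash_proj n k (as_to_trias n k x) = as_to_trias n k x.
Proof. by rewrite /= as_to_triasK. Qed.

Lemma AsNS_ind (Q : forall n k, AsNS n k -> Prop) :
  Q _ _ opM -> Q _ _ (ns_id AsNS) ->
  (forall m n r p q s (i : 'I_m) (hr : r.+1 = (m + n)%N) (hs : s = p + q) x y,
     Q m p x -> Q n q y -> Q r s (ns_comp i hr hs x y)) ->
  (forall n k, Q n k 0) -> (forall n k x, Q n k x -> Q n k (- x)) ->
  (forall n k x y, Q n k x -> Q n k y -> Q n k (x + y)) ->
  forall n k x, Q n k x.
Proof.
move=> hg hi hc h0 hN hD; apply: pres_ind => //; first by case.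
by move=> n k l h x _; rewrite AsNS_d.
Qed.

Lemma AsNS_arity0 k (x : AsNS 0%N k) : x = 0.
Proof. by apply: presented_arity0. Qed.

Lemma TriasNS_arity0 k (x : TriasNS 0%N k) : x = 0.
Proof. by apply: presented_arity0. Qed.

(** By associativity, multiplying the value of x on the right amounts to
    multiplying its last argument. *)
Lemma As_mul_comm n k (x : AsNS n k) (i : 'I_n) (hr : n.+2 = (2 + n)%N)
  (hr' : n.+2 = (n + 2)%N) (hs : k = 0 + k) (hs' : k = k + 0) :
  i.+1 = n ->
  ns_comp (ord0 : 'I_2) hr hs opM x = ns_comp i hr' hs' x opM.
Proof.
move: i hr hr' hs hs'; apply: (AsNS_ind (Q := fun n k x =>
  forall (i : 'I_n) (hr : n.+2 = (2 + n)%N)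
  (hr' : n.+2 = (n + 2)%N) (hs : k = 0 + k) (hs' : k = k + 0), i.+1 = n ->
  ns_comp (ord0 : 'I_2) hr hs opM x = ns_comp i hr' hs' x opM)) => {n k x}.
- move=> i hr hr' hs hs' hi.
  rewrite [RHS](ns_comp_irr _ hr' _ hs' (i' := ord_max)); last by case: hi.
  rewrite (eq_irrelevance hr erefl) (eq_irrelevance hr' erefl).
  rewrite (eq_irrelevance hs erefl) (eq_irrelevance hs' erefl).
  exact: AsNS_assoc.
- move=> i hr hr' hs hs' _.
  by rewrite ns_comp1r ns_comp1l.
- move=> m n r p q s j hr1 hs1 x y hx hy i hr hr' hs hs' hi.
  have hj := ltn_ord j; have hii := ltn_ord i.
  have e1 : m.+2 = (2 + m)%N by lia.
  have e2 : r.+2 = (m.+1 + n)%N by lia.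
  have e3 : m.+2 = (m + 2)%N by lia.
  have e4 : p = p + 0 by rewrite addr0.
  have e5 : p = 0 + p by rewrite add0r.
  pose j' : 'I_m.+1 := widen_ord (leqnSn m) j.
  rewrite -(ns_comp_seq e1 e5 e2 hs1 hr1 hs1 hr hs (k := j')) //.
  case: n => [|n] in y hy hr1 e2 *.
    by rewrite (AsNS_arity0 y) !ns_comp0r ns_comp0l.
  case: (eqVneq j.+1 m) => hjm.
    have e6 : n.+3 = (2 + n.+1)%N by [].
    have e7 : n.+3 = (n.+1 + 2)%N by lia.
    have e8 : q = 0 + q by rewrite add0r.
    have e9 : q = q + 0 by rewrite addr0.
    have e10 : r.+2 = (m + n.+2)%N by lia.
    rewrite (hx j e1 e3 e5 e4 hjm).
    rewrite (ns_comp_seq e3 e4 e2 hs1 e6 e8 e10 hs1 (j := ord0)) ?addn0 //.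
    rewrite (hy ord_max e6 e7 e8 e9 erefl).
    by rewrite -(ns_comp_seq hr1 hs1 hr' hs' e7 e9 e10 hs1 (k := i)) //=; lia.
  (* y is not grafted at the last input of x: the product moves to that input,
     in parallel with y *)
  have hl : (m.-1 < m)%N by lia.
  have hlm : (Ordinal hl).+1 = m by rewrite /=; lia.
  rewrite (hx _ e1 e3 e5 e4 hlm).
  rewrite (ns_comp_par hr1 hs1 hr' hs' e3 e4 e2 hs1
    (k := Ordinal hl) (i' := j')) //= ?mulr0 //; lia.
- move=> *; by rewrite ns_comp0l ns_comp0r.
- move=> n k x hx i hr hr' hs hs' hi.
  by rewrite ns_compNl ns_compNr (hx i hr hr' hs hs').
- move=> n k x y hx hy i hr hr' hs hs' hi.
  by rewrite ns_compDl ns_compDr (hx i hr hr' hs hs') // (hy i hr hr' hs hs').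
Qed.

(** * Operations grafted to the left of |- *)

Lemma vdash_proj_opL : vdash_proj 2%N 0 opL = opR.
Proof.
have [e _ _] := trias_to_asE.
by rewrite /= [X in as_to_trias _ _ X]e as_to_triasE.
Qed.

Lemma vdash_proj_opR : vdash_proj 2%N 0 opR = opR.
Proof. by rewrite -as_to_triasE vdash_proj_as. Qed.

Lemma vdash_proj_opX : vdash_proj 2%N 1 opX = 0.
Proof.
have [_ _ e] := trias_to_asE.
exact: etrans (congr1 _ e) (raddf0 (as_to_trias 2%N 1)).
Qed.

(** Grafted on the left of |-, the operation y acts only through its projection
    to a composite of copies of |-. *)
Definition left_absorbs n q (y : TriasNS n q) :=
  forall (hr : n.+2 = (2 + n)%N) (hs : q = 0 + q),
  ns_comp (ord0 : 'I_2) hr hs opR y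
    = ns_comp (ord0 : 'I_2) hr hs opR (vdash_proj n q y).

(** By [As_mul_comm] the last input of v, once v is grafted on the left of |-,
    is itself the left input of a |-. *)
Lemma left_absorbs_last m n r p q s (j : 'I_m) (hr : r.+1 = (m + n)%N)
  (hs : s = p + q) (v : AsNS m p) (y : TriasNS n q) :
  j.+1 = m -> left_absorbs y ->
  left_absorbs (ns_comp j hr hs (as_to_trias m p v) y).
Proof.
move=> hj hy hr0 hs0.
have e1 : m.+2 = (2 + m)%N by lia.
have e2 : p = 0 + p by rewrite add0r.
have e3 : r.+2 = (m.+1 + n)%N by lia.
have e4 : m.+2 = (m + 2)%N by lia.
have e5 : p = p + 0 by rewrite addr0.
have e6 : n.+2 = (2 + n)%N by lia.
have e7 : q = 0 + q by rewrite add0r.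
have e8 : r.+2 = (m + n.+1)%N by lia.
pose j' : 'I_m.+1 := widen_ord (leqnSn m) j.
have comm : ns_comp (ord0 : 'I_2) e1 e2 opR (as_to_trias m p v)
    = ns_comp j e4 e5 (as_to_trias m p v) opR.
  by rewrite -as_to_triasE -!nm_comp (As_mul_comm v e1 e4 e2 e5 hj).
have E (z : TriasNS n q) :
    ns_comp (ord0 : 'I_2) hr0 hs0 opR (ns_comp j hr hs (as_to_trias m p v) z)
    = ns_comp j e8 hs (as_to_trias m p v) (ns_comp (ord0 : 'I_2) e6 e7 opR z).
  rewrite -(ns_comp_seq e1 e2 e3 hs hr hs hr0 hs0 (k := j')) // comm.
  by rewrite (ns_comp_seq e4 e5 e3 hs e6 e7 e8 hs (j := ord0)) //= addn0.
by rewrite E hy -E nm_comp vdash_proj_as.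
Qed.

(** By induction on x, for all y at once: an input of a composite x1 o_k x2
    that is not the last is such an input of x1 or of x2, or else it is the last
    input of x2 while k is not the last input of x1. In the latter case y is
    first grafted onto x2, and [left_absorbs_last] allows the induction
    hypothesis for x1 to be applied to the result. *)
Lemma absorb_of_left_absorbs m p (x : AsNS m p) n q (y : TriasNS n q) r s
  (i : 'I_m) (hr : r.+1 = (m + n)%N) (hs : s = p + q) :
  left_absorbs y -> (i.+1 < m)%N ->
  ns_comp i hr hs (as_to_trias m p x) y
    = ns_comp i hr hs (as_to_trias m p x) (vdash_proj n q y).
Proof.
move: n q y r s i hr hs; apply: (AsNS_ind (Q := fun m p x =>
  forall n q (y : TriasNS n q) r s
  (i : 'I_m) (hr : r.+1 = (m + n)%N) (hs : s = p + q),
  left_absorbs y -> (i.+1 < m)%N ->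
  ns_comp i hr hs (as_to_trias m p x) y
    = ns_comp i hr hs (as_to_trias m p x) (vdash_proj n q y))) => {m p x}.
- move=> n q y r s i hr hs hy hi.
  have -> : i = ord0 by apply/val_inj => /=; lia.
  have es : s = q by rewrite hs add0r.
  have er : r = n.+1 by lia.
  revert hr hs; subst s r => hr hs.
  rewrite as_to_triasE.
  exact: hy.
- by move=> n q y r s i hr hs hy hi; have := ltn_ord i; lia.
- move=> m n r p q s k hr1 hs1 x1 x2 hx1 hx2 l t y w v i hr hs hy hi.
  rewrite nm_comp; set u1 := as_to_trias m p x1; set u2 := as_to_trias n q x2.
  have hk := ltn_ord k; have hii := ltn_ord i.
  have ea : (m + l).-1.+1 = (m + l)%N by lia.
  have eb : w.+1 = ((m + l).-1 + n)%N by lia.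
  have ec : v = p + t + q by rewrite hs hs1 addrAC.
  (* the input i lies before, inside or after the block of inputs of x2 *)
  case: (ltnP i k) => hik.
    have hk' : ((k + l).-1 < (m + l).-1)%N by lia.
    have him : (i < m)%N by lia.
    pose i0 : 'I_m := Ordinal him.
    have E (z : TriasNS l t) : ns_comp i hr hs (ns_comp k hr1 hs1 u1 u2) z
       = koszul (t * q)
           (ns_comp (Ordinal hk') eb ec (ns_comp i0 ea erefl u1 z) u2).
      rewrite (ns_comp_par ea erefl eb ec hr1 hs1 hr hs u1 z u2
        (k := k) (i' := i)) ?koszulK //=; lia.
    by rewrite !E hx1 //=; lia.
  case: (ltnP i (k + n)) => hikn.
    have hj : (i - k < n)%N by lia.
    have ed : (n + l).-1.+1 = (n + l)%N by lia.
    have ee : w.+1 = (m + (n + l).-1)%N by lia.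
    have ef : v = p + (q + t) by rewrite hs hs1 addrA.
    have E (z : TriasNS l t) : ns_comp i hr hs (ns_comp k hr1 hs1 u1 u2) z
       = ns_comp k ee ef u1 (ns_comp (Ordinal hj) ed erefl u2 z).
      by apply: ns_comp_seq => /=; lia.
    case: (ltnP (i - k).+1 n) => hjn.
      by rewrite !E hx2.
    rewrite !E hx1; last by lia.
      by rewrite nm_comp vdash_proj_as.
    by apply: left_absorbs_last => //=; lia.
  have hi0 : ((i - n).+1 < m)%N by lia.
  have hk' : (k < (m + l).-1)%N by lia.
  have E (z : TriasNS l t) : ns_comp i hr hs (ns_comp k hr1 hs1 u1 u2) z
     = koszul (q * t) (ns_comp (Ordinal hk') eb ec
                         (ns_comp (Ordinal hi0) ea erefl u1 z) u2).
    by apply: ns_comp_par => //=; lia.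
  by rewrite !E hx1 //=; lia.
- by move=> *; rewrite raddf0 !ns_comp0l.
- by move=> m p x hx n q y r s i hr hs hy hi; rewrite raddfN !ns_compNl hx.
- move=> m p x x' hx hx' n q y r s i hr hs hy hi.
  rewrite raddfD !ns_compDl.
  by congr (_ + _); [apply: hx | apply: hx'].
Qed.

(** By induction on y. For a composite y o_i z, the absorption of y turns
    |- o_1 y into a composite of copies of |-, and z is then grafted at one of
    its inputs other than the last. *)
Lemma TriasNS_left_absorbs n q (y : TriasNS n q) : left_absorbs y.
Proof.
move: n q y; apply: (pres_ind (Q := fun n q y => left_absorbs y)).
- case=> hr hs; rewrite (eq_irrelevance hr erefl) (eq_irrelevance hs erefl).
  + change (ncirc1 opR opL = ncirc1 opR (vdash_proj 2%N 0 opL)).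
    by rewrite vdash_proj_opL (law_R1 TriasNS_laws).
  + change (ncirc1 opR opR = ncirc1 opR (vdash_proj 2%N 0 opR)).
    by rewrite vdash_proj_opR.
  + change (ncirc1 opR opX = ncirc1 opR (vdash_proj 2%N 1 opX)).
    by rewrite vdash_proj_opX (law_RX0 TriasNS_laws) /ncirc1 ns_comp0r.
- by move=> hr hs; rewrite nm_id.
- move=> m n r p q s i hr1 hs1 y z hy hz hr hs.
  have hi := ltn_ord i.
  have e1 : m.+2 = (2 + m)%N by lia.
  have e2 : p = 0 + p by rewrite add0r.
  have e3 : r.+2 = (m.+1 + n)%N by lia.
  pose i' : 'I_m.+1 := widen_ord (leqnSn m) i.
  have E (u : TriasNS m p) (w : TriasNS n q) :
     ns_comp (ord0 : 'I_2) hr hs opR (ns_comp i hr1 hs1 u w)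
     = ns_comp i' e3 hs1 (ns_comp (ord0 : 'I_2) e1 e2 opR u) w.
    by symmetry; apply: ns_comp_seq.
  have -> : vdash_proj r s (ns_comp i hr1 hs1 y z)
     = ns_comp i hr1 hs1 (vdash_proj m p y) (vdash_proj n q z).
    by rewrite nm_comp.
  rewrite !E hy.
  have -> : ns_comp (ord0 : 'I_2) e1 e2 opR (vdash_proj m p y)
     = as_to_trias _ _ (ns_comp (ord0 : 'I_2) e1 e2 opM (trias_to_as m p y)).
    by rewrite nm_comp as_to_triasE.
  by apply: absorb_of_left_absorbs.
- move=> n k l h x hx hr hs; subst k.
  (* |- is a cycle of degree 0, so grafting on its left commutes with d *)
  have e : l + 1 = 0 + (l + 1) by rewrite add0r.
  have dE (z : TriasNS n (l + 1)) :
     cx_d erefl (ns_comp (ord0 : 'I_2) hr e opR z)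
     = ns_comp (ord0 : 'I_2) hr hs opR (cx_d erefl z).
    have e' : l = -1 + (l + 1) by rewrite addrC addrK.
    rewrite (ns_comp_d _ hr e degree_0N1 erefl erefl e' hs).
    by rewrite (law_dR TriasNS_laws) ns_comp0l add0r.
  by rewrite -dE hx dE cm_d.
- by move=> n k hr hs; rewrite raddf0.
- by move=> n k x hx hr hs; rewrite raddfN !ns_compNr hx.
- by move=> n k x y hx hy hr hs; rewrite raddfD !ns_compDr hx hy.
Qed.

Lemma vdash_proj_absorb m n r (p q s : int) (i : 'I_m) (hr : r.+1 = (m + n)%N)
  (hs : s = p + q) (x : TriasNS m p) (y : TriasNS n q) : (i.+1 < m)%N ->
  ns_comp i hr hs (vdash_proj m p x) y
    = ns_comp i hr hs (vdash_proj m p x) (vdash_proj n q y).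
Proof. exact/absorb_of_left_absorbs/TriasNS_left_absorbs. Qed.

(** * The contraction of Trias *)

Definition TriasHtpy := homotopy_operad TriasNS_arity0 vdash_proj_absorb.

Lemma TriasHtpy_laws : @trias_laws TriasHtpy (opL, opX) (opR, 0) (opX, 0).
Proof.
have [vL vR vX] := And3 vdash_proj_opL vdash_proj_opR vdash_proj_opX.
have H := TriasNS_laws.
have c1 p q (x : TriasNS 2%N p) a (y : TriasNS 2%N q) b :
  @ncirc1 TriasHtpy p q (x, a) (y, b) = (ncirc1 x y,
   ns_comp (ord0 : 'I_2) erefl (succ_degl erefl) a y)
   :> htpy_obj TriasNS 3%N (p + q) by [].
have c2 p q (x : TriasNS 2%N p) a (y : TriasNS 2%N q) b :
  @ncirc2 TriasHtpy p q (x, a) (y, b) = (ncirc2 x y,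
   ns_comp (ord_max : 'I_2) erefl (succ_degl erefl) a (vdash_proj 2%N q y)
     + koszul p (ns_comp (ord_max : 'I_2) erefl (succ_degr erefl) x b))
   :> htpy_obj TriasNS 3%N (p + q) by [].
have D l (x : TriasNS 2%N (l + 1)) a (h : l + 1 = l + 1) :
  @cx_d (TriasHtpy 2%N) (l + 1) l h (x, a)
  = (cx_d h x, x - vdash_proj 2%N (l + 1) x - cx_d (erefl (l + 1 + 1)) a)
  :> htpy_obj TriasNS 2%N l.
  by rewrite (eq_irrelevance h erefl).
have n1 p q (h : p + q = p + q) (x : TriasNS 2%N p) (y : TriasNS 2%N q) :
  ns_comp (ord0 : 'I_2) erefl h x y = ncirc1 x y.
  by rewrite (eq_irrelevance h erefl).
have n2 p q (h : p + q = p + q) (x : TriasNS 2%N p) (y : TriasNS 2%N q) :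
  ns_comp (ord_max : 'I_2) erefl h x y = ncirc2 x y.
  by rewrite (eq_irrelevance h erefl).
split; rewrite ?c1 ?c2 ?(vL, vR, vX) ?(ns_comp0l, ns_comp0r);
  rewrite ?addr0 ?add0r ?n1 ?n2.
- congr pair; [exact: (law_LR H)|exact: etrans (law_XR H) (esym (add0r _))].
- congr pair; [exact: (law_L2 H)|congr (_ + _); exact: (law_LX0 H)].
- congr pair; [exact: (law_L1 H)|exact: etrans (addr0 _) (esym (law_XLR H))].
- by congr pair; exact: (law_R1 H).
- congr pair; [exact: (law_R2 H)|exact: esym (addr0 _)].
- congr pair; [exact: (law_XR H)|exact: esym (addr0 _)].
- congr pair; [exact: (law_XL H)|exact: esym (law_XX H)].
- congr pair; [exact: (law_XLR H)|exact: esym (@oppr0 _)].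
- congr pair; exact: (law_RX0 H).
- congr pair; exact: (law_LX0 H).
- congr pair; [exact: (law_XX H)|exact: esym (opprK 0)].
- apply: etrans (D 0 opX 0 degree_10) _; congr pair; first exact: (law_dX H).
  by rewrite vX oppr0 addr0 (raddf0 (cx_d _)).
- apply: etrans (D (-1) opR 0 degree_0N1) _.
  congr pair; first exact: (law_dR H).
  by rewrite vR subrr (raddf0 (cx_d _)) subr0.
- apply: etrans (D (-1) opL opX degree_0N1) _.
  congr pair; first exact: (law_dL H).
  have dXe : cx_d (erefl (0 + 1)) opX = opL - opR.
    by rewrite -(law_dX H) (eq_irrelevance degree_10 erefl).
  rewrite vL; apply: etrans (congr1 (fun u => _ - u) dXe) _.
  exact: subrr.
Qed.

Definition trias_lift : nsMorphism TriasNS TriasHtpy :=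
  pres_morphism (trias_val_rel TriasHtpy_laws).

Lemma trias_lift_fst n k (x : TriasNS n k) : (trias_lift n k x).1 = x.
Proof.
apply: (pres_morphism_eq
  (f := nm_compose (homotopy_fst TriasNS_arity0 vdash_proj_absorb) trias_lift)
  (g := nm_identity TriasNS)) => g.
have := pres_morphism_gen (trias_val_rel TriasHtpy_laws) g.
by case: g => /(congr1 fst).
Qed.

(** This is dh + hd = id - e at a cycle. *)
Lemma vdash_proj_homotopy n k (x : TriasNS n k) : cyclep x ->
  exists y : TriasNS n (k + 1), cx_d (erefl (k + 1)) y = x - vdash_proj n k x.
Proof.
rewrite /cyclep => /eqP; move: (k - 1) (pred_degree k) => l h dx.
exists (trias_lift n k x).2; subst k.
have e : (trias_lift n l (cx_d erefl x)).2
    = (trias_lift n (l + 1) x).1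
      - vdash_proj n (l + 1) (trias_lift n (l + 1) x).1
      - cx_d erefl (trias_lift n (l + 1) x).2.
  exact: (congr1 (fun z : htpy_obj TriasNS n l => z.2)
           (cm_d (trias_lift n) erefl x)).
move: e; rewrite dx (raddf0 (trias_lift n l)) trias_lift_fst => /esym/eqP.
by rewrite subr_eq0 => /eqP ->.
Qed.

Lemma quasi_iso_retract (C D : complex) (f : chain_map C D)
  (g : chain_map D C) :
  (forall k (y : D k), f k (g k y) = y) ->
  (forall k (x : C k), cyclep x ->
     exists y : C (k + 1), cx_d (erefl (k + 1)) y = x - g k (f k x)) ->
  quasi_iso f.
Proof.
move=> fg gf k; exists (@homology_map D C g k) => x.
  rewrite -[x]reprK (homology_map_pi f) (homology_map_pi g); apply/eqP.
  rewrite -Quotient.idealrBE; apply/asboolP.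
  have [y hy] := gf k (val (repr x)) (cycleP (repr x)).
  by exists (- y); rewrite (raddfN (cx_d _)) hy opprB [RHS]raddfB.
rewrite -[x]reprK (homology_map_pi g) (homology_map_pi f).
congr (\pi_(homology D k) _).
by apply: val_inj; rewrite /= fg.
Qed.

(** * Passage to symmetric operads *)

Section Symmetrization.
Variables (P Q : nsOperad) (f : nsMorphism P Q).

Definition symm_map n k (x : symm_obj P n k) : symm_obj Q n k :=
  [ffun s => f n k (x s)].

Lemma symm_map_zmod_morphism n k : zmod_morphism (@symm_map n k).
Proof. by move=> x y; apply/ffunP=> s; rewrite !ffunE raddfB. Qed.

HB.instance Definition _ n k :=
  GRing.isZmodMorphism.Build (symm_obj P n k) (symm_obj Q n k)
    (@symm_map n k) (@symm_map_zmod_morphism n k).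

Lemma symm_map_d n k l (h : k = l + 1) (x : symm_obj P n k) :
  symm_map (symm_d h x) = symm_d h (symm_map x).
Proof. by apply/ffunP=> s; rewrite !ffunE cm_d. Qed.

Lemma symm_map_tens n k (x : P n k) s :
  symm_map (tens x s) = tens (f n k x) s.
Proof.
by apply/ffunP=> u; rewrite !ffunE; case: ifP => _; rewrite ?raddf0.
Qed.

Definition symm_chain_map n : chain_map (symm_cx P n) (symm_cx Q n) :=
  @ChainMap (symm_cx P n) (symm_cx Q n)
    (fun k => (@symm_map n k : {additive symm_obj P n k -> symm_obj Q n k}))
    (@symm_map_d n).

Definition symm_morphism : symMorphism (symmetrization P) (symmetrization Q).
Proof.
refine (@SymMorphism (symmetrization P) (symmetrization Q)
          symm_chain_map _ _ _).
- by rewrite /= symm_map_tens nm_id.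
- move=> m n r p q d i hr hd x y /=.
  elim/tens_ind: x => [x s|x x' hx hx']; last first.
    by rewrite symm_compDl !raddfD /= hx hx' -symm_compDl.
  elim/tens_ind: y => [y t|y y' hy hy']; last first.
    by rewrite symm_compDr !raddfD /= hy hy' -symm_compDr.
  have [j hj] := perm_preim s i.
  rewrite !symm_map_tens !(symm_comp_tens _ _ _ _ _ hj) symm_map_tens.
  by rewrite nm_comp.
- by move=> n k s x; apply/ffunP=> u; rewrite !ffunE.
Defined.

End Symmetrization.

(** The primitives of the components of a cycle are chosen independently for
    each permutation. *)
Lemma quasi_iso_symm (P Q : nsOperad) (f : nsMorphism P Q)
  (g : nsMorphism Q P) n :
  (forall k (y : Q n k), f n k (g n k y) = y) ->
  (forall k (x : P n k), cyclep x ->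
     exists y : P n (k + 1), cx_d (erefl (k + 1)) y = x - g n k (f n k x)) ->
  quasi_iso (symm_morphism f n).
Proof.
move=> fg gf; apply: (@quasi_iso_retract _ _ _ (symm_chain_map g n)).
  by move=> k y; apply/ffunP=> s; rewrite !ffunE fg.
move=> k x /eqP/ffunP hx.
have h s : exists y : P n (k + 1),
    cx_d (erefl (k + 1)) y = x s - g n k (f n k (x s)).
  by apply: gf; apply/eqP; have := hx s; rewrite !ffunE.
exists [ffun s => projT1 (cid (h s))]; apply/ffunP=> s.
by rewrite !ffunE; case: cid.
Qed.

(** Block permutations of identities are idempotent. *)
Lemma block_perm_id m n r (hr : r.+1 = (m + n)%N) (j : 'I_m) :
  block_perm hr j 1%g 1%g = 1%g.
Proof.
have := block_permM hr j 1%g 1%g 1%g 1%g.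
rewrite !mulg1 perm1 => e.
by apply: (mulgI (block_perm hr j 1%g 1%g)); rewrite -e mulg1.
Qed.

(** The symmetrization is generated under the symmetric groups by the elements
    tens x 1, and these compose as in the non-symmetric operad. *)
Lemma symm_morphism_unique (P : presentation) (Q : symOperad)
  (f g : symMorphism (symmetrization (presented_operad P)) Q) :
  (forall a : gen P,
     f _ _ (tens (tclass (tgen a) : presented_operad P _ _) 1%g)
     = g _ _ (tens (tclass (tgen a) : presented_operad P _ _) 1%g)) ->
  forall n k x, f n k x = g n k x.
Proof.
move=> fg n k x; elim/tens_ind: x => [x s|x y hx hy]; last first.
  by rewrite !raddfD hx hy.
have -> : tens x s
    = sym_act s (tens x 1%g : symmetrization (presented_operad P) n k).
  by rewrite /= symm_act_tens mul1g.
rewrite !sm_act; congr sym_act.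
have dT n' k' l (h : k' = l + 1) (z : presented_operad P n' k') :
   tens (cx_d h z) 1%g
     = cx_d h (tens z 1%g : symmetrization (presented_operad P) n' k').
  by rewrite /= symm_d_tens.
apply: (pres_ind (Q := fun n k x => f n k (tens x 1%g) = g n k (tens x 1%g)))
  => {n k x s} //.
- exact: etrans (sm_id f) (esym (sm_id g)).
- move=> m n r p q s i hr hs x y hx hy.
  have hi : i = (1%g : 'S_m) i by rewrite perm1.
  have -> : tens (ns_comp i hr hs x y) 1%g
     = @ns_comp (symmetrization (presented_operad P)) _ _ _ _ _ _ i hr hs
         (tens x 1%g) (tens y 1%g).
    by rewrite /= (symm_comp_tens _ _ _ _ _ hi) block_perm_id.
  by rewrite !sm_comp hx hy.
- by move=> n k l h x hx; rewrite dT !cm_d hx.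
- by move=> n k; rewrite tens0 !raddf0.
- by move=> n k x hx; rewrite tensN !raddfN hx.
- by move=> n k x y hx hy; rewrite tensD !raddfD hx hy.
Qed.

Theorem mainTheorem17 :
  exists f : symMorphism Trias As,
    (f 2%N 0 trias_dashv = as_mul /\ f 2%N 0 trias_vdash = as_mul /\
     f 2%N 1 trias_cross = 0) /\
    (forall g : symMorphism Trias As,
       g 2%N 0 trias_dashv = as_mul -> g 2%N 0 trias_vdash = as_mul ->
       g 2%N 1 trias_cross = 0 ->
       forall (n : nat) (k : int) (x : Trias n k), g n k x = f n k x) /\
    (forall n : nat, quasi_iso (f n)).
Proof.
have [eL eR eX] := trias_to_asE.
have fL : symm_morphism trias_to_as 2%N 0 trias_dashv = as_mul.
  exact: etrans (symm_map_tens _ _ _) (congr1 (fun x => tens x 1%g) eL).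
have fR : symm_morphism trias_to_as 2%N 0 trias_vdash = as_mul.
  exact: etrans (symm_map_tens _ _ _) (congr1 (fun x => tens x 1%g) eR).
have fX : symm_morphism trias_to_as 2%N 1 trias_cross = 0.
  apply: etrans (symm_map_tens _ _ _) _.
  exact: etrans (congr1 (fun x => tens x 1%g) eX) (tens0 _ _).
exists (symm_morphism trias_to_as); split; [by [] | split].
  move=> g gL gR gX; apply: symm_morphism_unique; case.
  - exact: etrans gL (esym fL).
  - exact: etrans gR (esym fR).
  - exact: etrans gX (esym fX).
move=> n; apply: (@quasi_iso_symm _ _ _ as_to_trias).
  exact: as_to_triasK.
exact: vdash_proj_homotopy.
Qed.
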